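(* Let $n_1\ge n_2\ge 1$ be integers and $\sigma>0$. Suppose that $y=\theta^*(\pi_1^*,\pi_2^* )+\varepsilon$, where $\theta^*\in\mathcal{M}^{n_1,n_2}$, $\pi_1^*\in\mathcal{S}_{n_1}$, $\pi_2^*\in\mathcal{S}_{n_2}$ and $\varepsilon\sim\mathsf{subG}_{n_1\times n_2}(\sigma^2)$. Let $y=\sum_{i=1}^{n_2}\lambda_iu_iv_i^\top$ be the singular value decomposition of $y$, and define the singular value thresholding estimator $$\hat\theta^{\mathsf{svt}}:=\sum_{i=1}^{n_2}\mathbf{1}\{\lambda_i>\rho\}\,\lambda_iu_iv_i^\top,\qquad \rho:=C\sigma\sqrt{n_1},$$ for a sufficiently large universal constant $C>0$. Then $$\frac{1}{n_1n_2}\|\hat\theta^{\mathsf{svt}}-\theta^*(\pi_1^*,\pi_2^* )\|_F^2\;\lesssim\;\left[\frac{\sigma^2}{n_2}+\frac{\sigma^{3/2}V(\theta^* )^{1/2}}{n_2^{3/4}}\right]\wedge\sigma^2$$ with probability at least $1-\exp(-n_1)$. Moreover, the same bound holds in expectation.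
   Context: A matrix $\theta\in\mathbb{R}^{n_1\times n_2}$ is anti-Monge if $\theta_{i,j}+\theta_{k,\ell}\ge\theta_{i,\ell}+\theta_{k,j}$ for all $1\le i\le k\le n_1$, $1\le j\le\ell\le n_2$; the set of such matrices is $\mathcal{M}^{n_1,n_2}$. For $\theta\in\mathcal{M}^{n_1,n_2}$, $V(\theta):=\theta_{1,1}+\theta_{n_1,n_2}-\theta_{n_1,1}-\theta_{1,n_2}$. $\mathcal{S}_n$ is the set of permutations of $\{1,\dots,n\}$, and $\theta(\pi_1,\pi_2)_{i,j}:=\theta_{\pi_1(i),\pi_2(j)}$. A zero-mean random matrix $\varepsilon\in\mathbb{R}^{n_1\times n_2}$ satisfies $\varepsilon\sim\mathsf{subG}_{n_1\times n_2}(\sigma^2)$ if $\mathbb{E}[\exp(\mathrm{Tr}(M^\top\varepsilon))]\le\exp(\sigma^2\|M\|_F^2/2)$ for every $M\in\mathbb{R}^{n_1\times n_2}$. $\|\cdot\|_F$ is the Frobenius norm; $a\wedge b=\min(a,b)$; $a\lesssim b$ means $a\le C'b$ for a universal constant $C'>0$. ''The same bound holds in expectation'' means that the expectation of the left-hand side is $\lesssim$ the right-hand side. *)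

(* Defs.v *)
From HB Require Import structures.
From mathcomp Require Import all_boot all_order all_algebra all_fingroup.
From mathcomp Require Import all_classical all_reals all_analysis.

Set Implicit Arguments.
Unset Strict Implicit.
Unset Printing Implicit Defensive.

Import Order.TTheory GRing.Theory Num.Theory.

Local Open Scope ring_scope.

(* Indices run over 'I_n = {0, ..., n-1}, so the 1-based index i is i-1 here. *)
Definition anti_Monge (R : realType) (n1 n2 : nat) (theta : 'M[R]_(n1, n2)) :
    Prop :=
  forall (i k : 'I_n1) (j l : 'I_n2), (i <= k)%N -> (j <= l)%N ->
    theta i j + theta k l >= theta i l + theta k j.

(* The dimensions are successors so that the corner entries exist. *)
Definition corner_variation (R : realType) (m1 m2 : nat)
    (theta : 'M[R]_(m1.+1, m2.+1)) : R :=
  theta ord0 ord0 + theta ord_max ord_max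
  - theta ord_max ord0 - theta ord0 ord_max.

Definition permuted (R : realType) (n1 n2 : nat) (theta : 'M[R]_(n1, n2))
    (pi1 : 'S_n1) (pi2 : 'S_n2) : 'M[R]_(n1, n2) :=
  \matrix_(i, j) theta (pi1 i) (pi2 j).

(* The library norm `|A| on matrices is the maximum norm, not this one. *)
Definition frobenius (R : realType) (n1 n2 : nat) (A : 'M[R]_(n1, n2)) : R :=
  Num.sqrt (\sum_i \sum_j A i j ^+ 2).

(* A random matrix is a map from T to matrices with measurable entries. *)
Definition subG (R : realType) (d : measure_display) (T : measurableType d)
    (P : probability T R) (n1 n2 : nat) (sigma2 : R)
    (eps : T -> 'M[R]_(n1, n2)) : Prop :=
  [/\ forall i j, measurable_fun [set: T] (fun w => eps w i j),
      forall i j, ('E_P[fun w => eps w i j] = 0)%E &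
      forall M : 'M[R]_(n1, n2),
        ('E_P[fun w => expR (\tr (M^T *m eps w))]
          <= (expR (sigma2 * frobenius M ^+ 2 / 2))%:E)%E].

(* Thin singular value decomposition for n2 <= n1: the columns of u and of v
   are the left and right singular vectors. *)
Definition is_svd (R : realType) (n1 n2 : nat) (y : 'M[R]_(n1, n2))
    (lam : 'I_n2 -> R) (u : 'M[R]_(n1, n2)) (v : 'M[R]_n2) : Prop :=
  [/\ forall i, 0 <= lam i,
      forall i j : 'I_n2, (i <= j)%N -> lam j <= lam i,
      u^T *m u = 1%:M,
      v^T *m v = 1%:M &
      y = \sum_i lam i *: (col i u *m (col i v)^T)].

Definition svt (R : realType) (n1 n2 : nat) (rho : R)
    (lam : 'I_n2 -> R) (u : 'M[R]_(n1, n2)) (v : 'M[R]_n2) : 'M[R]_(n1, n2) :=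
  \sum_(i | rho < lam i) lam i *: (col i u *m (col i v)^T).

(* Main.v *)
Require Import Defs.
From HB Require Import structures.
From mathcomp Require Import all_boot all_order all_algebra all_fingroup.
From mathcomp Require Import all_classical all_reals all_analysis.
From mathcomp Require Import measurable_realfun.
From mathcomp Require Import ring lra zify.

Set Implicit Arguments.
Unset Strict Implicit.
Unset Printing Implicit Defensive.

Import Order.TTheory GRing.Theory Num.Theory.
Import numFieldNormedType.Exports.

Local Open Scope ring_scope.

(* Cutting rows and columns into O(r) blocks approximates an anti-Monge matrix A
   by B of rank O(r) with |A - B|_F^2 <= n1 n2 V^2 / r^3. If the noise has
   operator norm at most rho / 2, then at most 2 rank B + 4 |A - B|_F^2 / rho^2
   singular values of y exceed rho, so hat - A agrees with B - A up to a matrix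
   of rank O(r + |A - B|_F^2 / rho^2) and operator norm O(rho); balancing r gives
   the rate. The operator norm of the noise is controlled through the exponential
   moments of its bilinear form on pairs of lattice points of the unit balls: one
   nonnegative variable of mean at most exp (- n1) bounds both the exceptional
   probability and the contribution of the exceptional event to the mean.
   Thresholding does not depend on the chosen decomposition, being a limit of
   rational functions of y, which makes the loss measurable. *)

(** * Squared Frobenius norm and orthogonal projections *)

Section FrobeniusSquare.
Variable R : realFieldType.

(** The norm is kept squared, so the algebra needs no square root and holds over any real field. *)
Definition sqfro m n (A : 'M[R]_(m, n)) : R := \sum_i \sum_j A i j ^+ 2.

Lemma sqfroE m n (A : 'M[R]_(m, n)) : sqfro A = \tr (A *m A^T).
Proof.
by apply: eq_bigr => i _; rewrite mxE; apply: eq_bigr => j _; rewrite mxE expr2.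
Qed.

Lemma sqfro_ge0 m n (A : 'M[R]_(m, n)) : 0 <= sqfro A.
Proof. by apply: sumr_ge0 => i _; apply: sumr_ge0 => j _; apply: sqr_ge0. Qed.

Lemma sqfro_tr m n (A : 'M[R]_(m, n)) : sqfro A^T = sqfro A.
Proof. by rewrite !sqfroE trmxK mxtrace_mulC. Qed.

Lemma sqfro_row m n (A : 'M[R]_(m, n)) : sqfro A = \sum_i sqfro (row i A).
Proof.
apply: eq_bigr => i _; rewrite /sqfro big_ord1.
by apply: eq_bigr => j _; rewrite mxE.
Qed.

Lemma sqfro_col m n (A : 'M[R]_(m, n)) : sqfro A = \sum_j sqfro (col j A).
Proof.
rewrite -sqfro_tr sqfro_row; apply: eq_bigr => j _.
by rewrite -tr_col sqfro_tr.
Qed.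

Lemma sqfroZ m n a (A : 'M[R]_(m, n)) : sqfro (a *: A) = a ^+ 2 * sqfro A.
Proof.
rewrite /sqfro mulr_sumr; apply: eq_bigr => i _; rewrite mulr_sumr.
by apply: eq_bigr => j _; rewrite mxE exprMn.
Qed.

Lemma sqfroN m n (A : 'M[R]_(m, n)) : sqfro (- A) = sqfro A.
Proof. by rewrite -scaleN1r sqfroZ sqrrN expr1n mul1r. Qed.

Lemma sqfro_eq0 m n (A : 'M[R]_(m, n)) : (sqfro A == 0) = (A == 0).
Proof.
apply/eqP/eqP => [A0|->]; last first.
  by rewrite /sqfro big1 // => i _; rewrite big1 // => j _; rewrite mxE expr0n.
apply/matrixP => i j; rewrite mxE; apply/eqP; rewrite -sqrf_eq0; apply/eqP.
have /psumr_eq0P := A0 => /(_ (fun i _ => sumr_ge0 _ (fun j _ => sqr_ge0 _))).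
move=> /(_ i isT) /psumr_eq0P -> // ? _; exact: sqr_ge0.
Qed.

Lemma sqfroD m n (A B : 'M[R]_(m, n)) :
  sqfro (A + B) = sqfro A + sqfro B + 2 * \tr (A *m B^T).
Proof.
have BA : \tr (B *m A^T) = \tr (A *m B^T) by rewrite -mxtrace_tr trmx_mul trmxK.
rewrite !sqfroE linearD /= mulmxDl !mulmxDr !mxtraceD BA; ring.
Qed.

Lemma sqfro_mul_orthoT m n p (Z : 'M[R]_(m, p)) (v : 'M[R]_(n, p)) :
  v^T *m v = 1%:M -> sqfro (Z *m v^T) = sqfro Z.
Proof.
by move=> vv; rewrite !sqfroE trmx_mul trmxK mulmxA -(mulmxA Z) vv mulmx1.
Qed.

Definition orthoproj n (P : 'M[R]_n) := P^T = P /\ P *m P = P.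

Lemma orthoprojB n (P : 'M[R]_n) : orthoproj P -> orthoproj (1%:M - P).
Proof.
case=> tP PP; split; first by rewrite linearB /= trmx1 tP.
by rewrite mulmxBl mul1mx mulmxBr mulmx1 PP subrr subr0.
Qed.

Lemma sqfro_orthoproj n (P : 'M[R]_n) : orthoproj P -> sqfro P = \tr P.
Proof. by case=> tP PP; rewrite sqfroE tP PP. Qed.

(** Pythagoras: the cross term is a trace that cycles to one containing [(1 - P) P = 0]. *)
Lemma sqfro_mul_orthoproj m n (P : 'M[R]_m) (Z : 'M[R]_(m, n)) :
  orthoproj P -> sqfro Z = sqfro (P *m Z) + sqfro ((1%:M - P) *m Z).
Proof.
move=> oP; have [tP PP] := oP; have [tQ QQ] := orthoprojB oP.
have -> : Z = P *m Z + (1%:M - P) *m Z by rewrite -mulmxDl addrC subrK mul1mx.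
rewrite sqfroD.
have -> : P *m (P *m Z + (1%:M - P) *m Z) = P *m Z.
  by rewrite -mulmxDl [P + _]addrC subrK mul1mx.
have -> : (1%:M - P) *m (P *m Z + (1%:M - P) *m Z) = (1%:M - P) *m Z.
  by rewrite -mulmxDl [P + _]addrC subrK mul1mx.
rewrite [X in _ + 2 * X](_ : _ = 0) ?mulr0 ?addr0 //.
rewrite trmx_mul tQ mxtrace_mulC -!mulmxA (mulmxA _ P) mulmxBl mul1mx PP subrr.
by rewrite mul0mx mulmx0 mxtrace0.
Qed.

Lemma sqfro_mul_orthoproj_le m n (P : 'M[R]_m) (Z : 'M[R]_(m, n)) :
  orthoproj P -> sqfro (P *m Z) <= sqfro Z.
Proof. by move=> oP; rewrite (sqfro_mul_orthoproj Z oP) lerDl sqfro_ge0. Qed.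

Lemma orthoproj_mulT m n (u : 'M[R]_(m, n)) :
  u^T *m u = 1%:M -> orthoproj (u *m u^T).
Proof.
move=> uu; split; first by rewrite trmx_mul trmxK.
by rewrite mulmxA -(mulmxA u) uu mulmx1.
Qed.

(** Bessel's inequality for the columns of [u]: [Z u] has the norm of [Z u u^T], whose rows are
    projections of the rows of [Z]. *)
Lemma sqfro_mul_ortho_le m n p (Z : 'M[R]_(p, m)) (u : 'M[R]_(m, n)) :
  u^T *m u = 1%:M -> sqfro (Z *m u) <= sqfro Z.
Proof.
move=> uu; rewrite -[X in _ <= X]sqfro_tr.
apply: le_trans (sqfro_mul_orthoproj_le Z^T (orthoproj_mulT uu)).
by rewrite -(sqfro_mul_orthoT _ uu) -sqfro_tr !trmx_mul !trmxK mulmxA.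
Qed.

Lemma ortho_col m n (u : 'M[R]_(m, n)) i :
  u^T *m u = 1%:M -> sqfro (col i u) = 1.
Proof.
move=> /matrixP/(_ i i); rewrite !mxE eqxx mulr1n => <-.
by apply: eq_bigr => k _; rewrite big_ord1 !mxE expr2.
Qed.

(** For a full rank factorization [M = X Y], the projection is [X (X^T X)^-1 X^T]. The Gram matrix
    [G] is invertible because [w G w^T] is the squared norm of [w X^T]. *)
Lemma exists_orthoproj m n (M : 'M[R]_(m, n)) :
  exists P : 'M[R]_m, [/\ orthoproj P, sqfro P = (\rank M)%:R & P *m M = M].
Proof.
have [X [Y [XY rX]]] : exists (X : 'M[R]_(m, \rank M)) (Y : 'M[R]_(_, n)),
    X *m Y = M /\ row_full X.
  by exists (col_base M), (row_base M); rewrite mulmx_base col_base_full.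
pose G := X^T *m X.
have uG : G \in unitmx.
  rewrite -row_free_unit; apply/row_freeP/row_freeP/inj_row_free => w wG0.
  have wX0 : w *m X^T = 0.
    apply/eqP; rewrite -sqfro_eq0 sqfroE trmx_mul trmxK -mulmxA.
    by rewrite (mulmxA _ X) (mulmxA w) wG0 mul0mx mxtrace0.
  have /row_freeP[Z XZ] : row_free X^T.
    by rewrite /row_free mxrank_tr.
  by rewrite -[w]mulmx1 -XZ mulmxA wX0 mul0mx.
have tG : G^T = G by rewrite trmx_mul trmxK.
pose P := X *m invmx G *m X^T.
have PX : P *m X = X by rewrite /P -!mulmxA mulVmx ?mulmx1.
have oP : orthoproj P.
  split; first by rewrite /P !trmx_mul trmxK trmx_inv tG mulmxA.
  by rewrite {2}/P !mulmxA PX.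
exists P; split => //.
- rewrite sqfro_orthoproj // /P -mulmxA mxtrace_mulC -mulmxA -/G mulVmx //.
  by rewrite mxtrace1.
- by rewrite -XY mulmxA PX.
Qed.

End FrobeniusSquare.

(** * Singular value thresholding for a fixed noise matrix *)

Section OperatorBound.
Variable R : realFieldType.

Lemma col_mulmx m n p (X : 'M[R]_(m, n)) (Y : 'M[R]_(n, p)) j :
  col j (X *m Y) = X *m col j Y.
Proof. by rewrite !colE mulmxA. Qed.

(* By homogeneity this says that the operator norm of X is at most b. *)
Definition opnorm_le m n (X : 'M[R]_(m, n)) (b : R) := forall x y,
  2 * (x *m X *m y : 'M[R]_1) 0 0 <= b * (sqfro x + sqfro y).

Lemma opnorm_leD m n (X Y : 'M[R]_(m, n)) b c :
  opnorm_le X b -> opnorm_le Y c -> opnorm_le (X + Y) (b + c).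
Proof.
move=> Xb Yc x y; rewrite mulmxDr mulmxDl mxE.
by have := Xb x y; have := Yc x y; lra.
Qed.

Lemma opnorm_leN m n (X : 'M[R]_(m, n)) b : opnorm_le X b -> opnorm_le (- X) b.
Proof.
move=> Xb x y; have := Xb (- x) y.
by rewrite sqfroN !mulNmx mulmxN mulNmx.
Qed.

Lemma opnorm_leW m n (X : 'M[R]_(m, n)) b c :
  b <= c -> opnorm_le X b -> opnorm_le X c.
Proof.
move=> bc Xb x y; apply: le_trans (Xb x y) _.
by rewrite ler_wpM2r // addr_ge0 ?sqfro_ge0.
Qed.

Lemma opnorm_le_tr m n (X : 'M[R]_(m, n)) b : opnorm_le X b -> opnorm_le X^T b.
Proof.
move=> Xb x y; rewrite addrC -(sqfro_tr x) -(sqfro_tr y).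
suff -> : (x *m X^T *m y) 0 0 = (y^T *m X *m x^T) 0 0 by exact: Xb.
have -> : y^T *m X *m x^T = (x *m X^T *m y)^T by rewrite !trmx_mul trmxK mulmxA.
by rewrite [RHS]mxE.
Qed.

(** Testing each row [x] of [Z] against [b^-1 (x X)^T] gives [2 |x X|^2 <= b^2 |x|^2 + |x X|^2]. *)
Lemma sqfro_mul_opnorm_le m n p (Z : 'M[R]_(p, m)) (X : 'M[R]_(m, n)) b :
  0 < b -> opnorm_le X b -> sqfro (Z *m X) <= b ^+ 2 * sqfro Z.
Proof.
move=> b0 Xb; rewrite sqfro_row (sqfro_row Z) mulr_sumr; apply: ler_sum => i _.
rewrite row_mul; set x := row i Z; set w := x *m X.
have := Xb x (b^-1 *: w^T); rewrite sqfroZ sqfro_tr -scalemxAr mxE.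
rewrite -/w (_ : (w *m w^T) 0 0 = sqfro w); last first.
  by rewrite sqfroE /mxtrace big_ord1.
move=> h; have := ler_wpM2l (ltW b0) h.
rewrite (_ : b * (2 * _) = 2 * sqfro w); last by field; rewrite gt_eqF.
rewrite (_ : b * (b * _) = b ^+ 2 * sqfro x + sqfro w); last first.
  by field; rewrite gt_eqF.
lra.
Qed.

Lemma sqfro_opnorm_le m n (X : 'M[R]_(m, n)) b :
  0 < b -> opnorm_le X b -> sqfro X <= b ^+ 2 * n%:R.
Proof.
move=> b0 Xb; rewrite -sqfro_tr -[X in sqfro X]mul1mx.
apply: le_trans (sqfro_mul_opnorm_le _ b0 (opnorm_le_tr Xb)) _.
by rewrite sqfroE trmx1 mulmx1 mxtrace1.
Qed.

(** Young's inequality, from [(a s - t)^2 >= 0] in each coordinate. *)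
Lemma two_dot_le n (x z : 'cV[R]_n) a : 0 < a ->
  2 * (x^T *m z) 0 0 <= a * sqfro x + a^-1 * sqfro z.
Proof.
move=> a0; rewrite mxE /sqfro !mulr_sumr -big_split; apply: ler_sum => i _ /=.
rewrite !big_ord1 mxE; set s := x i 0; set t := z i 0.
rewrite -subr_ge0.
suff -> : a * s ^+ 2 + a^-1 * t ^+ 2 - 2 * (s * t) = a^-1 * (a * s - t) ^+ 2.
  by rewrite mulr_ge0 ?sqr_ge0 // invr_ge0 ltW.
by field; rewrite gt_eqF.
Qed.

End OperatorBound.

(** * Matrices given by singular vectors and coefficients *)

Section SingularSums.
Variables (R : realFieldType) (n : nat).

(** Arbitrary coefficients and a rectangular [v] let transposes, thresholded matrices and functions
    of Gram matrices share this form. *)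
Definition svd_mx m p (u : 'M[R]_(m, n)) (v : 'M[R]_(p, n)) (a : 'I_n -> R) :
    'M[R]_(m, p) :=
  \sum_i a i *: (col i u *m (col i v)^T).

Lemma svd_mx_diag m p (u : 'M[R]_(m, n)) (v : 'M[R]_(p, n)) a :
  svd_mx u v a = u *m diag_mx (\row_i a i) *m v^T.
Proof.
apply/matrixP => i j; rewrite summxE mul_mx_diag mxE; apply: eq_bigr => k _.
by rewrite !mxE big_ord1 !mxE; ring.
Qed.

Lemma svd_mxE m p (u : 'M[R]_(m, n)) (v : 'M[R]_(p, n)) a i j :
  svd_mx u v a i j = \sum_k a k * (u i k * v j k).
Proof.
rewrite summxE; apply: eq_bigr => k _.
by rewrite !mxE big_ord1 !mxE.
Qed.

Lemma tr_svd_mx m p (u : 'M[R]_(m, n)) (v : 'M[R]_(p, n)) a :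
  (svd_mx u v a)^T = svd_mx v u a.
Proof.
by apply/matrixP => i j; rewrite mxE !svd_mxE; apply: eq_bigr => k _; ring.
Qed.

(** Orthonormality of the shared family makes the product act on coefficients: a functional calculus
    for Gram matrices. *)
Lemma mul_svd_mx m p q (u : 'M[R]_(m, n)) (v : 'M[R]_(p, n)) (w : 'M[R]_(q, n)) a b :
  v^T *m v = 1%:M ->
  svd_mx u v a *m svd_mx v w b = svd_mx u w (fun i => a i * b i).
Proof.
move=> vv; rewrite !svd_mx_diag !mulmxA -(mulmxA _ v^T) vv mulmx1.
rewrite -(mulmxA u) mulmx_diag; congr (_ *m diag_mx _ *m _).
by apply/matrixP => i j; rewrite !mxE.
Qed.

End SingularSums.

(** * Thresholding error under an operator norm bound on the noise *)

Section Thresholding.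
Variables (R : realFieldType) (m n : nat).
Variables (u : 'M[R]_(m, n)) (v : 'M[R]_n) (lam : 'I_n -> R) (rho : R).
Hypotheses (uu : u^T *m u = 1%:M) (vv : v^T *m v = 1%:M).
Hypotheses (lam_ge0 : forall i, 0 <= lam i) (rho_gt0 : 0 < rho).

Local Notation svd_mx := (svd_mx u v).

Definition thresholded i := if rho < lam i then lam i else 0.

Lemma svd_mx_thresholded :
  svd_mx thresholded = \sum_(i | rho < lam i) lam i *: (col i u *m (col i v)^T).
Proof.
rewrite [RHS]big_mkcond; apply: eq_bigr => i _; rewrite /thresholded.
by case: ifP => // _; rewrite scale0r.
Qed.

(** The residual has coefficients in [[0, rho]], so each singular direction contributes at most
    [rho (a^2 + b^2)]; Bessel's inequality sums these. *)
Lemma opnorm_le_residual : opnorm_le (svd_mx lam - svd_mx thresholded) rho.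
Proof.
move=> x y; pose c i := lam i - thresholded i.
have c0 i : 0 <= c i <= rho.
  rewrite /c /thresholded; case: ltP => h; first by rewrite subrr lexx ltW.
  by rewrite subr0 lam_ge0.
have -> : x *m (svd_mx lam - svd_mx thresholded) *m y =
    \sum_k c k *: ((x *m col k u) *m ((col k v)^T *m y)).
  rewrite -sumrB mulmx_sumr mulmx_suml; apply: eq_bigr => k _.
  by rewrite -scalerBl -scalemxAr -scalemxAl !mulmxA.
rewrite summxE.
have xu : sqfro (x *m u) <= sqfro x by exact: sqfro_mul_ortho_le.
have yv : sqfro (v^T *m y) <= sqfro y.
  by rewrite -sqfro_tr -(sqfro_tr y) trmx_mul trmxK sqfro_mul_ortho_le.
apply: (@le_trans _ _ (rho * (sqfro (x *m u) + sqfro (v^T *m y)))); last first.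
  by rewrite ler_pM2l // lerD.
rewrite (sqfro_col (x *m u)) (sqfro_row (v^T *m y)) -big_split !mulr_sumr.
apply: ler_sum => k _ /=; rewrite col_mulmx row_mul -tr_col.
rewrite !mxE /sqfro !big_ord1; set a := (x *m _) 0 0; set b := (_ *m y) 0 0.
have /andP[c1 c2] := c0 k; have := sqr_ge0 (a - b); have := sqr_ge0 (a + b).
rewrite !sqrrD sqrrN mulrN => h1 h2.
have : 0 <= c k * (a ^+ 2 + b ^+ 2 - 2 * (a * b)) by apply: mulr_ge0 => //; lra.
have : 0 <= (rho - c k) * (a ^+ 2 + b ^+ 2).
  by apply: mulr_ge0; rewrite ?subr_ge0 // addr_ge0 ?sqr_ge0.
lra.
Qed.

Lemma rank_thresholded :
  (\rank (svd_mx thresholded) <= #|[set i | (rho < lam i)%R]|)%N.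
Proof.
rewrite svd_mx_thresholded cardsE -sum1_card.
elim/big_rec2: _ => [|i k M _ rM]; first by rewrite mxrank0.
apply: leq_trans (mxrank_add _ _) (leq_add _ rM).
apply: leq_trans (mxrank_scale _ _) _.
by apply: leq_trans (mxrankM_maxl _ _) (rank_leq_col _).
Qed.

Lemma svd_mx_mul_col i : svd_mx lam *m col i v = lam i *: col i u.
Proof.
rewrite mulmx_suml (bigD1 i) //= big1 ?addr0.
  rewrite -scalemxAl -mulmxA [X in _ *m X](_ : _ = 1%:M) ?mulmx1 //.
  apply/matrixP => a b; have /matrixP/(_ i i) := vv.
  rewrite !ord1 !mxE !eqxx => vv1; apply: etrans vv1.
  by apply: eq_bigr => k _; rewrite !mxE.
move=> k ki; rewrite -scalemxAl -mulmxA [X in _ *m X](_ : _ = 0) ?mulmx0 ?scaler0 //.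
apply/matrixP => a b; have /matrixP/(_ k i) := vv.
rewrite !mxE (negPf ki) => vv0; apply: etrans vv0.
by apply: eq_bigr => l _; rewrite !mxE.
Qed.

(** [B] stands for a low rank approximation of the signal, [D] for the approximation error and [E]
    for the noise. *)
Variables (B D E : 'M[R]_(m, n)) (tau : R).
Hypotheses (yE : svd_mx lam = B + D + E) (Etau : opnorm_le E tau).
Hypothesis (tau_rho : 2 * tau <= rho).

(* A singular direction with value above rho that is far from the column space
   of B must be explained by D, the noise accounting for at most half of it. *)
Lemma card_large_singular :
  #|[set i | rho < lam i]|%:R <= 2 * (\rank B)%:R + 4 * sqfro D / rho ^+ 2.
Proof.
set s : R := #|_|%:R; have [P [oP trP PB]] := exists_orthoproj B.
have [tQ QQ] := orthoprojB oP; set Q := 1%:M - P in tQ QQ.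
have QB : Q *m B = 0 by rewrite mulmxBl mul1mx PB subrr.
(* Pairing [c] with [y v_i] gives [lam i * |c|^2], and [Q] removes [B]. Young's inequality with
   weight [rho / 2] handles [D]; the noise term is at most [rho (|c|^2 + 1) / 4]. *)
have far i : rho < lam i ->
    sqfro (Q *m col i u) <= 2 * sqfro (D *m col i v) / rho ^+ 2 + 2^-1.
  move=> rl; set c := Q *m col i u.
  have e1 : (c^T *m svd_mx lam *m col i v) 0 0 = lam i * sqfro c.
    rewrite -mulmxA svd_mx_mul_col -scalemxAr mxE; congr (_ * _).
    rewrite -sqfro_tr sqfroE /mxtrace big_ord1 trmxK /c trmx_mul tQ -!mulmxA.
    by rewrite (mulmxA Q) QQ.
  have e2 : c^T *m svd_mx lam *m col i v =
      c^T *m (D *m col i v) + c^T *m E *m col i v.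
    rewrite yE mulmxDr mulmxDl mulmxDr mulmxDl; congr (_ + _).
    by rewrite /c trmx_mul tQ -(mulmxA _ Q B) QB mulmx0 mul0mx add0r !mulmxA.
  have := Etau c^T (col i v); rewrite sqfro_tr (ortho_col _ vv) => h1.
  have r20 : 0 < rho / 2 by rewrite divr_gt0.
  have h2 := two_dot_le c (D *m col i v) r20.
  have h3 : lam i * sqfro c = (c^T *m (D *m col i v)) 0 0 + (c^T *m E *m col i v) 0 0.
    by rewrite -e1 e2 mxE.
  have c0 : 0 <= sqfro c := sqfro_ge0 c.
  have h4 : rho * sqfro c <= lam i * sqfro c by rewrite ler_wpM2r // ltW.
  have h5 : 2 * tau * (sqfro c + 1) <= rho * (sqfro c + 1).
    by rewrite ler_wpM2r // addr_ge0.
  rewrite invf_div in h2.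
  have h6 : rho * sqfro c <= 2 / rho * sqfro (D *m col i v) + rho / 2 by lra.
  rewrite -(ler_pM2l rho_gt0); apply: le_trans h6 _.
  rewrite le_eqVlt; apply/orP; left; apply/eqP; field; by rewrite gt_eqF.
have sE : s = \sum_(i | rho < lam i) 1.
  by rewrite sumr_const /s cardsE.
have s1 : s <= \sum_(i | rho < lam i) (sqfro (P *m col i u)
    + (2 * sqfro (D *m col i v) / rho ^+ 2 + 2^-1)).
  rewrite sE; apply: ler_sum => i rl; have := ortho_col i uu.
  rewrite (sqfro_mul_orthoproj _ oP) => u1; have := far i rl; rewrite -/Q in u1 *; lra.
(* By Bessel's inequality this sum is at most [|P|_F^2], which is the rank of [B]. *)
have s2 : \sum_(i | rho < lam i) sqfro (P *m col i u) <= (\rank B)%:R.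
  rewrite -trP; apply: le_trans (sqfro_mul_ortho_le P uu).
  rewrite (sqfro_col (P *m u)) [X in _ <= X](bigID (fun i => rho < lam i)) /=.
  rewrite (eq_bigr (fun i => sqfro (col i (P *m u)))); last first.
    by move=> i _; rewrite col_mulmx.
  by rewrite lerDl sumr_ge0 // => i _; apply: sqfro_ge0.
have s3 : \sum_(i | rho < lam i) sqfro (D *m col i v) <= sqfro D.
  apply: le_trans (sqfro_mul_ortho_le D vv).
  rewrite (sqfro_col (D *m v)) [X in _ <= X](bigID (fun i => rho < lam i)) /=.
  rewrite (eq_bigr (fun i => sqfro (col i (D *m v)))); last first.
    by move=> i _; rewrite col_mulmx.
  by rewrite lerDl sumr_ge0 // => i _; apply: sqfro_ge0.
(* What remains is [s <= rank B + 2 |D|^2 / rho^2 + s / 2]; absorbing [s / 2] doubles the other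
   terms. *)
rewrite !big_split /= -mulr_suml -mulr_sumr in s1.
have e4 : \sum_(i | rho < lam i) 2^-1 = s / 2.
  by rewrite sE mulr_suml; apply: eq_bigr => i _; rewrite mul1r.
rewrite e4 in s1.
have r0 : 0 <= (rho ^+ 2)^-1 by rewrite invr_ge0 sqr_ge0.
have := ler_wpM2r r0 s3; lra.
Qed.

Lemma opnorm_le_thresholding_error :
  opnorm_le (svd_mx thresholded - (B + D)) (rho + tau).
Proof.
set H := svd_mx thresholded; set A := B + D.
have -> : H - A = - (svd_mx lam - H) + E.
  by rewrite yE -/A; move: (A) => A'; rewrite opprB opprD addrA addrNK.
by apply: opnorm_leD => //; apply/opnorm_leN/opnorm_le_residual.
Qed.

(** Let [P] project on the joint column space of the estimator and [B]. Outside it the error is just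
    [- D]; inside it the operator norm is at most [b] and the dimension is at most the number of
    large singular values plus the rank of [B]. *)
Lemma sqfro_thresholding_error b : 0 < b -> rho + tau <= b ->
  sqfro (svd_mx thresholded - (B + D)) <=
    b ^+ 2 * (3 * (\rank B)%:R + 4 * sqfro D / rho ^+ 2) + sqfro D.
Proof.
move=> b0 rtb; set H := svd_mx thresholded; set A := B + D.
have Xb := opnorm_leW rtb opnorm_le_thresholding_error.
have [P [oP trP PM]] := exists_orthoproj (row_mx H B).
rewrite (sqfro_mul_orthoproj _ oP).
rewrite mul_mx_row in PM; have [PH PB] := eq_row_mx PM.
have -> : (1%:M - P) *m (H - A) = - ((1%:M - P) *m D).
  rewrite /A opprD addrA mulmxBr [X in X - _](_ : _ = 0) ?sub0r //.
  by rewrite mulmxBr !mulmxBl !mul1mx PH PB !subrr.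
rewrite sqfroN lerD ?sqfro_mul_orthoproj_le //; last exact: orthoprojB.
apply: le_trans (sqfro_mul_opnorm_le _ b0 Xb) _.
rewrite ler_pM2l ?exprn_gt0 // trP.
have rk : (\rank (row_mx H B) <= #|[set i | (rho < lam i)%R]| + \rank B)%N.
  rewrite -mxrank_tr tr_row_mx.
  apply: leq_trans (_ : _ <= \rank H^T + \rank B^T)%N _.
    by rewrite -addsmxE; apply: mxrank_adds_leqif.
  by rewrite !mxrank_tr leq_add2r rank_thresholded.
rewrite -(ler_nat R) natrD in rk; have := card_large_singular; lra.
Qed.

End Thresholding.

(** * Low rank approximation of anti-Monge matrices *)

Section AntiMongeApproximation.
Variable R : realType.

(** Each unit of lag adds a telescoping sum of at most [g N - g 0]. *)
Lemma sum_increments_le (g : nat -> R) (N L : nat) :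
  (forall i j, (i <= j <= N)%N -> g i <= g j) ->
  \sum_(i < N.+1) (g i - g (i - L)%N) <= L%:R * (g N - g 0%N).
Proof.
move=> gm; elim: L => [|L IH].
  by rewrite mul0r big1 // => i _; rewrite subn0 subrr.
have -> : \sum_(i < N.+1) (g i - g (i - L.+1)%N) =
    \sum_(i < N.+1) (g i - g (i - L)%N) +
    \sum_(i < N.+1) (g (i - L)%N - g (i - L.+1)%N).
  by rewrite -big_split; apply: eq_bigr => i _ /=; lra.
(* Truncated subtraction cancels the term of index 0; the others telescope to [g (N - L) - g 0]. *)
rewrite -natr1 mulrDl mul1r lerD // big_ord_recl !sub0n subrr add0r.
rewrite (eq_bigr (fun i : 'I_N => g (i.+1 - L)%N - g (i - L)%N)); last first.
  by move=> i _; rewrite lift0 subSS.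
rewrite -(big_mkord predT (fun i => g (i.+1 - L)%N - g (i - L)%N)).
by rewrite telescope_sumr // sub0n lerB ?gm //; lia.
Qed.

Lemma sum_block_increments_le (g : nat -> R) (rep : nat -> nat) (N L : nat) :
  (forall i j, (i <= j <= N)%N -> g i <= g j) ->
  (forall i, (i <= N)%N -> (rep i <= i <= rep i + L)%N) ->
  \sum_(i < N.+1) (g i - g (rep i)) <= L%:R * (g N - g 0%N).
Proof.
move=> gm repP; apply: le_trans (sum_increments_le L gm).
apply: ler_sum => i _; rewrite lerB // gm //.
by have := repP i (leq_ord i); have := leq_ord i; lia.
Qed.

(** The matrix factors through the 0/1 matrix that assigns a label to each column. *)
Lemma rank_factor_col m n r (F : 'I_m -> nat -> R) (lab : 'I_n -> nat) :
  (forall j, lab j < r)%N -> (\rank (\matrix_(i, j) F i (lab j)) <= r)%N.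
Proof.
move=> labr; pose X := \matrix_(i < m, c < r) F i c.
pose Y : 'M[R]_(r, n) := \matrix_(c, j) ((c : nat) == lab j)%:R.
suff -> : \matrix_(i, j) F i (lab j) = X *m Y.
  exact: leq_trans (mxrankM_maxl _ _) (rank_leq_col _).
apply/matrixP => i j; rewrite !mxE (bigD1 (Ordinal (labr j))) //= !mxE eqxx mulr1.
rewrite big1 ?addr0 // => c; rewrite -val_eqE /= => /negPf cj.
by rewrite !mxE cj mulr0.
Qed.

Lemma rank_factor_row m n r (F : nat -> 'I_n -> R) (lab : 'I_m -> nat) :
  (forall i, lab i < r)%N -> (\rank (\matrix_(i, j) F (lab i) j) <= r)%N.
Proof.
move=> labr; rewrite -mxrank_tr.
have -> : (\matrix_(i, j) F (lab i) j)^T = \matrix_(j, i) F (lab i) j.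
  by apply/matrixP => i j; rewrite !mxE.
exact: (@rank_factor_col _ _ r (fun j c => F c j)).
Qed.

(** Each label is sent to its smallest index, and an unattained label to [ord0]. Taking the label as
    argument is what lets representatives enter a rank bound. *)
Lemma first_with_label n (lab : 'I_n.+1 -> nat) :
  exists f : nat -> 'I_n.+1,
    forall i, (f (lab i) <= i)%N /\ lab (f (lab i)) = lab i.
Proof.
suff /choice[f fP] : forall c, exists k : 'I_n.+1, forall i, lab i = c ->
    (k <= i)%N /\ lab k = c by exists f => i; exact: fP.
move=> c; have [[i0 i0c]|no] := pselect (exists i, lab i = c); last first.
  by exists ord0 => i ic; case: no; exists i.
have [k /eqP kc kmin] := @arg_minnP _ i0 (fun i => lab i == c) val (introT eqP i0c).
by exists k => i /eqP ic; split => //; exact: kmin.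
Qed.

(** With equal quotients, [(i - k) * r] is a difference of remainders, hence below [n.+1]. *)
Lemma equal_quotient_dist n r i k : (0 < r)%N -> (k <= i)%N ->
  ((i * r) %/ n.+1 = (k * r) %/ n.+1)%N -> (i <= k + n.+1 %/ r)%N.
Proof.
move=> r0 ki e; rewrite -leq_subLR leq_divRL //.
have := divn_eq (i * r) n.+1; have := divn_eq (k * r) n.+1.
have := ltn_pmod (i * r) (ltn0Sn n); rewrite e mulnBl; lia.
Qed.

Variables (m1 m2 : nat) (theta : 'M[R]_(m1.+1, m2.+1)).
Hypothesis theta_aM : anti_Monge theta.

(** Mixed second difference over a rectangle. It is additive when a side is cut, hence acts as a
    measure of total mass [V]. *)
Definition rect (a b : 'I_m1.+1) (c d : 'I_m2.+1) :=
  theta a c + theta b d - theta a d - theta b c.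

Lemma rect_ge0 (a b : 'I_m1.+1) (c d : 'I_m2.+1) :
  (a <= b)%N -> (c <= d)%N -> 0 <= rect a b c d.
Proof. by move=> ab cd; have := theta_aM ab cd; rewrite /rect; lra. Qed.

Local Notation V := (corner_variation theta).

Lemma corner_variationE : V = rect ord0 ord_max ord0 ord_max.
Proof. by rewrite /corner_variation /rect; lra. Qed.

Lemma corner_variation_ge0 : 0 <= V.
Proof. by rewrite corner_variationE rect_ge0. Qed.

(** The one-dimensional bound is applied twice: along the columns within the strip from [f1 i] to
    [i], then along the rows for strips of full width. *)
Lemma sum_rect_le (f1 : 'I_m1.+1 -> 'I_m1.+1) (f2 : 'I_m2.+1 -> 'I_m2.+1) L1 L2 :
  (forall i, f1 i <= i <= f1 i + L1)%N -> (forall j, f2 j <= j <= f2 j + L2)%N ->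
  \sum_i \sum_j rect (f1 i) i (f2 j) j <= L1%:R * L2%:R * V.
Proof.
move=> f1P f2P.
pose r1 i := f1 (inord i) : nat; pose r2 j := f2 (inord j) : nat.
have step2 i : \sum_j rect (f1 i) i (f2 j) j <=
    L2%:R * rect (f1 i) i ord0 ord_max.
  pose g j := rect (f1 i) i ord0 (inord j).
  rewrite (eq_bigr (fun j : 'I_m2.+1 => g j - g (r2 j))); last first.
    by move=> j _; rewrite /g /r2 !inord_val /rect; lra.
  apply: le_trans (@sum_block_increments_le g r2 m2 L2 _ _) _.
  - move=> a b /andP[ab bm].
    have := @rect_ge0 (f1 i) i (inord a) (inord b); rewrite !inordK; try lia.
    by case/andP: (f1P i) => -> _ /(_ isT ab); rewrite /g /rect; lra.
  - by move=> j jm; have := f2P (inord j); rewrite /r2 inordK.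
  rewrite ler_wpM2l // /g -[inord m2]/(inord (val (ord_max : 'I_m2.+1))).
  by rewrite -[inord 0]/(inord (val (ord0 : 'I_m2.+1))) !inord_val /rect; lra.
apply: le_trans (ler_sum _ (fun i _ => step2 i)) _.
rewrite -mulr_sumr (mulrC L1%:R) -mulrA ler_wpM2l //.
pose g i := rect ord0 (inord i) ord0 ord_max.
rewrite (eq_bigr (fun i : 'I_m1.+1 => g i - g (r1 i))); last first.
  by move=> i _; rewrite /g /r1 !inord_val /rect; lra.
apply: le_trans (@sum_block_increments_le g r1 m1 L1 _ _) _.
- move=> a b /andP[ab bm].
  have := @rect_ge0 (inord a) (inord b) ord0 ord_max; rewrite !inordK; try lia.
  by move=> /(_ ab isT); rewrite /g /rect; lra.
- by move=> i im; have := f1P (inord i); rewrite /r1 inordK.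
rewrite ler_wpM2l // /g corner_variationE -[inord m1]/(inord (val (ord_max : 'I_m1.+1))).
by rewrite -[inord 0]/(inord (val (ord0 : 'I_m1.+1))) !inord_val /rect; lra.
Qed.

(* Rows are cut into at most 2r blocks, each of length at most n1/r and carrying
   at most a fraction 1/r of the variation; columns into r blocks of length at
   most n2/r. On a product of two blocks theta is replaced by the sum of a
   function of the row and a function of the column. *)
Lemma anti_Monge_low_rank (pi1 : 'S_m1.+1) (pi2 : 'S_m2.+1) (r : nat) : (0 < r)%N ->
  exists B : 'M[R]_(m1.+1, m2.+1), (\rank B <= 3 * r)%N /\
    sqfro (permuted theta pi1 pi2 - B) <=
      m1.+1%:R * m2.+1%:R * V ^+ 2 / r%:R ^+ 3.
Proof.
move=> r0; have rR0 : 0 < r%:R :> R by rewrite ltr0n.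
pose M i := rect ord0 i ord0 ord_max.
have M0 i : 0 <= M i by exact: rect_ge0.
have MV i : M i <= V.
  have := @rect_ge0 i ord_max ord0 ord_max (leq_ord i) isT.
  by rewrite corner_variationE /M /rect; lra.
pose q1 (i : 'I_m1.+1) := ((i * r) %/ m1.+1)%N.
pose q2 (j : 'I_m2.+1) := ((j * r) %/ m2.+1)%N.
(* For [V = 0] the quotient is 0 by convention and all rows get label 0. The value [r] is attained
   when [M i = V > 0], so [p1 + q1] ranges below [2 * r]. *)
pose p1 (i : 'I_m1.+1) := Num.truncn (r%:R * M i / V).
have p1r i : (p1 i <= r)%N.
  suff /le_truncn : r%:R * M i / V <= r%:R by rewrite natrK.
  have [->|V0] := eqVneq V 0; first by rewrite invr0 mulr0 ler0n.
  have Vgt0 : 0 < V by rewrite lt_neqAle eq_sym V0 corner_variation_ge0.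
  by rewrite ler_pdivrMr // ler_wpM2l.
have q1r i : (q1 i < r)%N by rewrite /q1 ltn_divLR // mulnC ltn_mul2l r0 ltn_ord.
have q2r j : (q2 j < r)%N by rewrite /q2 ltn_divLR // mulnC ltn_mul2l r0 ltn_ord.
have Mmono (i k : 'I_m1.+1) : (i <= k)%N -> M i <= M k.
  move=> ik; have := @rect_ge0 i k ord0 ord_max ik isT.
  by rewrite /M /rect; lra.
have p1mono (i k : 'I_m1.+1) : (i <= k)%N -> (p1 i <= p1 k)%N.
  move=> ik; rewrite /p1; apply: le_truncn; rewrite ler_wpM2r //.
    by rewrite invr_ge0 corner_variation_ge0.
  by rewrite ler_wpM2l // Mmono.
have q1mono (i k : 'I_m1.+1) : (i <= k)%N -> (q1 i <= q1 k)%N.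
  by move=> ik; rewrite leq_div2r // leq_mul2r ik orbT.
(* Both labels are nondecreasing, so two rows with equal sums agree in each label: the sum indexes
   the common refinement. *)
have [f1 f1P] := first_with_label (fun i => p1 i + q1 i)%N.
have [f2 f2P] := first_with_label q2.
pose rep1 i := f1 (p1 i + q1 i)%N; pose rep2 j := f2 (q2 j).
have rep1_le i : (rep1 i <= i)%N by case: (f1P i).
have rep2_le j : (rep2 j <= j)%N by case: (f2P j).
have [rep1_p rep1_q] : (forall i, p1 (rep1 i) = p1 i) /\ (forall i, q1 (rep1 i) = q1 i).
  split=> i; have [_] := f1P i; rewrite -/(rep1 i) => e;
    have := p1mono _ _ (rep1_le i); have := q1mono _ _ (rep1_le i); lia.
have rep2_q j : q2 (rep2 j) = q2 j by case: (f2P j).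
have Mrep i : M i - M (rep1 i) <= V / r%:R.
  have [V0|V0] := eqVneq V 0.
    have := MV i; have := M0 i; have := M0 (rep1 i); rewrite V0 mul0r; lra.
  have Vgt0 : 0 < V by rewrite lt_neqAle eq_sym V0 corner_variation_ge0.
  have x0 k : 0 <= r%:R * M k / V by rewrite divr_ge0 ?mulr_ge0 // ltW.
  have /andP[_ h1] := truncn_itv (x0 i); have /andP[h2 _] := truncn_itv (x0 (rep1 i)).
  rewrite -/(p1 _) -natr1 in h1; rewrite -/(p1 _) rep1_p in h2.
  have : r%:R * M i / V < r%:R * M (rep1 i) / V + 1 by lra.
  rewrite -(ltr_pM2r Vgt0) mulrDl !divfK ?gt_eqF // mul1r => h3.
  rewrite ler_pdivlMr // mulrBl; lra.
pose E i j := rect (rep1 i) i (rep2 j) j.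
have E0 i j : 0 <= E i j by exact: rect_ge0.
have EV i j : E i j <= V / r%:R.
  apply: le_trans (Mrep i).
  have := @rect_ge0 (rep1 i) i ord0 (rep2 j) (rep1_le i) isT.
  have := @rect_ge0 (rep1 i) i j ord_max (rep1_le i) (leq_ord j).
  by rewrite /E /M /rect; lra.
have sumE : \sum_i \sum_j E i j <= m1.+1%:R / r%:R * (m2.+1%:R / r%:R) * V.
  apply: le_trans (_ : _ <= (m1.+1 %/ r)%N%:R * (m2.+1 %/ r)%N%:R * V) _.
    apply: sum_rect_le => [i|j]; apply/andP; split => //.
      by apply: equal_quotient_dist => //; have := rep1_q i; rewrite /q1.
    by apply: equal_quotient_dist => //; have := rep2_q j; rewrite /q2.
  have dr k : (k %/ r)%N%:R <= k%:R / r%:R :> R.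
    by rewrite ler_pdivlMr // -natrM ler_nat leq_trunc_div.
  by rewrite ler_wpM2r ?corner_variation_ge0 // ler_pM.
(* The column part takes [r] labels and the row part [2 * r]. What is left at each entry is exactly
   the mass [E] of the rectangle down to the representatives. *)
pose B : 'M[R]_(m1.+1, m2.+1) :=
  (\matrix_(i, j) theta (pi1 i) (f2 (q2 (pi2 j)))) +
  \matrix_(i, j) (theta (f1 (p1 (pi1 i) + q1 (pi1 i))%N) (pi2 j)
    - theta (f1 (p1 (pi1 i) + q1 (pi1 i))%N) (rep2 (pi2 j))).
exists B; split.
  apply: leq_trans (mxrank_add _ _) _; rewrite (mulnDl 1 2) mul1n leq_add //.
    exact: (@rank_factor_col _ _ r (fun i c => theta (pi1 i) (f2 c))
      (fun j => q2 (pi2 j))).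
  apply: (@rank_factor_row _ _ (2 * r) (fun c j => theta (f1 c) (pi2 j)
      - theta (f1 c) (rep2 (pi2 j))) (fun i => p1 (pi1 i) + q1 (pi1 i))%N) => i.
  by have := p1r (pi1 i); have := q1r (pi1 i); lia.
have -> : sqfro (permuted theta pi1 pi2 - B) = \sum_i \sum_j E i j ^+ 2.
  rewrite [RHS](reindex_inj (@perm_inj _ pi1)); apply: eq_bigr => i _.
  rewrite [RHS](reindex_inj (@perm_inj _ pi2)); apply: eq_bigr => j _.
  by congr (_ ^+ 2); rewrite !mxE /E /rect /rep1 /rep2; lra.
(* One factor of [E ^+ 2] is bounded uniformly by [V / r], the other is summed to order [r^-2];
   together they give [r^-3]. *)
apply: (@le_trans _ _ (V / r%:R * \sum_i \sum_j E i j)).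
  rewrite mulr_sumr; apply: ler_sum => i _; rewrite mulr_sumr.
  by apply: ler_sum => j _; rewrite expr2 ler_wpM2r.
apply: le_trans (ler_wpM2l _ sumE) _.
  by rewrite divr_ge0 ?corner_variation_ge0.
rewrite le_eqVlt; apply/orP; left; apply/eqP; field; by rewrite gt_eqF.
Qed.

End AntiMongeApproximation.

(** * Operator norm through a lattice net *)

Section LatticeNet.
Variable R : realType.

(** Inverse of the lattice spacing: rounding [n.+1] coordinates costs at most [n.+1 / mesh^2 = 1/16]
    in squared norm. *)
Definition mesh (n : nat) : R := 4 * Num.sqrt n.+1%:R.

Lemma mesh_gt0 n : 0 < mesh n.
Proof. by rewrite mulr_gt0 // sqrtr_gt0 ltr0n. Qed.

Lemma mesh_sqr n : mesh n ^+ 2 = (16 * n.+1)%:R.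
Proof. by rewrite exprMn sqr_sqrtr ?ler0n // natrM; lra. Qed.

(** A sign and an absolute value per coordinate; the range suffices since [k <= k^2 <= mesh^2] in
    the unit ball. *)
Definition lattice_code n := {ffun 'I_n.+1 -> bool * 'I_(16 * n.+1).+1}.

Definition lattice_point n (f : lattice_code n) : 'cV[R]_n.+1 :=
  \col_i ((-1) ^+ (f i).1 * (f i).2%:R / mesh n).

(** The unit ball condition, multiplied by [mesh n ^+ 2] to stay in the integers. *)
Definition lattice_net n : {set lattice_code n} :=
  [set f : lattice_code n | (\sum_i (f i).2 ^ 2 <= 16 * n.+1)%N].

Lemma sum_half_pow_le (K : nat) : \sum_(k < K) (2^-1 : R) ^+ k <= 2.
Proof.
suff -> : \sum_(k < K) (2^-1 : R) ^+ k = 2 - 2 * 2^-1 ^+ K.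
  by rewrite gerBl mulr_ge0 // exprn_ge0 // invr_ge0.
elim: K => [|K IH]; first by rewrite big_ord0 expr0; lra.
by rewrite big_ord_recr /= IH exprS; lra.
Qed.

(* Exponential Markov inequality for counting lattice points in a ball. *)
Lemma card_lattice_net n : #|lattice_net n|%:R <= 2 ^+ (18 * n.+1) :> R.
Proof.
pose h (f : lattice_code n) : R := \prod_i 2^-1 ^+ (f i).2.
have h0 (f : lattice_code n) : 0 <= h f by apply: prodr_ge0 => i _; rewrite exprn_ge0 // invr_ge0.
have hE (f : lattice_code n) : f \in lattice_net n -> 1 <= 2 ^+ (16 * n.+1) * h f.
  rewrite inE => fN; rewrite /h prodrXr exprVn -ler_pdivrMr ?invr_gt0 ?exprn_gt0 //.
  rewrite mul1r invrK ler_weXn2l ?ler1n //.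
  apply: leq_trans fN; apply: leq_sum => i _.
  by case: ((f i).2 : nat) => // k; rewrite expnS expn1 leq_pmulr.
rewrite -sum1_card natr_sum.
apply: le_trans (_ : _ <= \sum_(f in lattice_net n) 2 ^+ (16 * n.+1) * h f) _.
  by apply: ler_sum => f; apply: hE.
apply: le_trans (_ : _ <= \sum_f 2 ^+ (16 * n.+1) * h f) _.
  rewrite [X in _ <= X](bigID (mem (lattice_net n))) /= lerDl sumr_ge0 // => f _.
  by rewrite mulr_ge0 ?exprn_ge0.
(* The total weight factors over coordinates. Each factor is twice a geometric sum, at most
   [4 = 2^2], whence [18 = 16 + 2]. *)
rewrite -mulr_sumr /h.
rewrite -(bigA_distr_bigA (fun (i : 'I_n.+1) (c : bool * 'I_(16 * n.+1).+1) =>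
  (2^-1 : R) ^+ c.2)) /=.
rewrite prodr_const card_ord (_ : 18 * n.+1 = 16 * n.+1 + 2 * n.+1)%N; last by lia.
rewrite exprD ler_pM2l ?exprn_gt0 // exprM lerXn2r ?nnegrE ?exprn_ge0 //.
  by apply: sumr_ge0 => c _; rewrite exprn_ge0 // invr_ge0.
rewrite -(pair_big predT predT (fun (b : bool) (k : 'I_(16 * n.+1).+1) =>
  (2^-1 : R) ^+ k)) /=.
rewrite big_bool /=; have := sum_half_pow_le (16 * n.+1).+1; lra.
Qed.

Lemma sqfro_lattice_point n (f : lattice_code n) :
  f \in lattice_net n -> sqfro (lattice_point f) <= 1.
Proof.
rewrite inE => fN; rewrite /sqfro.
rewrite (eq_bigr (fun i => (((f i).2 ^ 2)%N%:R) / mesh n ^+ 2)); last first.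
  move=> i _; rewrite big_ord1 mxE expr_div_n exprMn -exprM mulnC exprM sqrrN.
  by rewrite expr1n expr1n mul1r natrX.
rewrite -mulr_suml ler_pdivrMr ?exprn_gt0 ?mesh_gt0 // mul1r mesh_sqr.
by rewrite -natr_sum ler_nat.
Qed.

(** Rounding every coordinate towards 0 stays in the ball and moves each coordinate by at most
    [1 / mesh n]. *)
Lemma lattice_rounding n (x : 'cV[R]_n.+1) : sqfro x <= 1 ->
  exists2 f, f \in lattice_net n & sqfro (x - lattice_point f) <= 16^-1.
Proof.
move=> x1; have c0 := mesh_gt0 n.
pose a i := Num.truncn (mesh n * `|x i 0|).
have aP i : (a i)%:R <= mesh n * `|x i 0| < (a i).+1%:R.
  by rewrite truncn_itv // mulr_ge0 // ltW.
have suma : (\sum_i a i ^ 2 <= 16 * n.+1)%N.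
  rewrite -(ler_nat R) natr_sum -mesh_sqr.
  apply: le_trans (_ : _ <= mesh n ^+ 2 * sqfro x) _; last first.
    by rewrite ler_piMr // exprn_ge0 // ltW.
  rewrite /sqfro mulr_sumr; apply: ler_sum => i _; rewrite big_ord1 natrX.
  rewrite -(real_normK (num_real (x i 0))) -exprMn lerXn2r ?nnegrE //.
    by rewrite mulr_ge0 // ltW.
  by case/andP: (aP i).
have ale i : (a i < (16 * n.+1).+1)%N.
  rewrite ltnS; apply: leq_trans suma; rewrite (bigD1 i) //=.
  apply: leq_trans (leq_addr _ _).
  by case: (a i) => // k; rewrite expnS expn1 leq_pmulr.
pose f : lattice_code n := [ffun i => (x i 0 < 0, inord (a i))].
exists f.
  rewrite inE; apply: leq_trans suma; apply: leq_sum => i _.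
  by rewrite ffunE /= inordK.
rewrite /sqfro; apply: le_trans (_ : _ <= \sum_(i < n.+1) (mesh n ^+ 2)^-1) _.
  apply: ler_sum => i _; rewrite big_ord1 !mxE ffunE /= inordK //.
  have -> : x i 0 - (-1) ^+ (x i 0 < 0)%R * (a i)%:R / mesh n =
      (-1) ^+ (x i 0 < 0)%R * (`|x i 0| - (a i)%:R / mesh n).
    by rewrite mulrBr -mulrA -numEsign.
  rewrite exprMn -exprM mulnC exprM sqrrN !expr1n mul1r -exprVn.
  have /andP[h1 h2] := aP i.
  have e : mesh n * (`|x i 0| - (a i)%:R / mesh n) = mesh n * `|x i 0| - (a i)%:R.
    by field; rewrite gt_eqF.
  have c0' := ltW c0; rewrite lerXn2r ?nnegrE ?invr_ge0 //.
    by rewrite -(pmulr_rge0 _ c0) e subr_ge0.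
  by rewrite -(ler_pM2l c0) e divff ?gt_eqF //; rewrite -natr1 in h2; lra.
rewrite sumr_const card_ord mesh_sqr natrM -mulr_natr le_eqVlt; apply/orP; left.
by apply/eqP; field; rewrite gt_eqF // addrC natr1 ltr0n.
Qed.

(** Rounding errors have norm at most 1/4, so the supremum [S] of the form over unit balls satisfies
    [S <= b + S/4 + S/4]. Homogeneity and [2 p q <= p^2 + q^2] then give the claim. *)
Lemma opnorm_le_net m n (X : 'M[R]_(m.+1, n.+1)) (b : R) :
  (forall f g, f \in lattice_net m -> g \in lattice_net n ->
    ((lattice_point f)^T *m X *m lattice_point g) 0 0 <= b) ->
  opnorm_le X (2 * b).
Proof.
move=> Xb; pose val (x : 'cV[R]_m.+1) (y : 'cV[R]_n.+1) := (x^T *m X *m y) 0 0.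
pose E := [set r | exists x y, [/\ sqfro x <= 1, sqfro y <= 1 & r = val x y]]%classic.
have coord k (x : 'cV[R]_k) i : sqfro x <= 1 -> `|x i 0| <= 1.
  move=> x1; rewrite -(@expr_le1 _ 2) // real_normK ?num_real //.
  apply: le_trans x1; rewrite /sqfro (bigD1 i) //= big_ord1 lerDl.
  by apply: sumr_ge0 => j _; apply: sumr_ge0 => l _; apply: sqr_ge0.
have valE x y : val x y = \sum_j \sum_i x i 0 * X i j * y j 0.
  rewrite /val mxE; apply: eq_bigr => j _; rewrite mxE mulr_suml.
  by apply: eq_bigr => i _; rewrite mxE.
(* Boundedness by the sum of the absolute entries makes [sup E] a genuine upper bound. *)
have supE : has_sup E.
  split; first by exists (val 0 0), 0, 0; split=> //;
    rewrite (_ : sqfro 0 = 0) ?ler01 //; apply/eqP; rewrite sqfro_eq0.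
  exists (\sum_j \sum_i `|X i j|) => r [x [y [x1 y1 ->]]].
  rewrite valE; apply: ler_sum => j _; apply: ler_sum => i _.
  apply: le_trans (ler_norm _) _; rewrite !normrM.
  have := coord _ _ i x1; have := coord _ _ j y1 => h1 h2.
  rewrite -[X in _ <= X]mulr1 ler_pM ?mulr_ge0 //.
  by rewrite -[X in _ <= X]mul1r ler_pM.
have valS x y : sqfro x <= 1 -> sqfro y <= 1 -> val x y <= sup E.
  by move=> x1 y1; apply: sup_upper_bound => //; exists x, y.
have val4 x y : sqfro x <= 16^-1 -> sqfro y <= 1 -> val x y <= sup E / 4.
  move=> x1 y1; have := valS (4 *: x) y; rewrite sqfroZ => h.
  have {}h : val (4 *: x) y <= sup E by apply: h => //; lra.
  have e : val (4 *: x) y = 4 * val x y.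
    by rewrite /val linearZ /= -!scalemxAl mxE.
  by rewrite e in h; lra.
have val4' x y : sqfro x <= 1 -> sqfro y <= 16^-1 -> val x y <= sup E / 4.
  move=> x1 y1; have := valS x (4 *: y); rewrite sqfroZ => h.
  have {}h : val x (4 *: y) <= sup E by apply: h => //; lra.
  have e : val x (4 *: y) = 4 * val x y by rewrite /val -!scalemxAr mxE.
  by rewrite e in h; lra.
have S2 : sup E <= 2 * b.
  suff : sup E <= b + sup E / 2 by lra.
  apply: ge_sup; first by case: supE.
  move=> r [x [y [x1 y1 ->]]].
  have [f fN xf] := lattice_rounding x1; have [g gN yg] := lattice_rounding y1.
  have e : val x y = val (lattice_point f) (lattice_point g) +
      val (x - lattice_point f) y + val (lattice_point f) (y - lattice_point g).
    rewrite !valE -!big_split; apply: eq_bigr => j _; rewrite -!big_split.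
    by apply: eq_bigr => i _ /=; rewrite !mxE; ring.
  have h1 := Xb _ _ fN gN; have h2 := val4 _ _ xf y1.
  have h3 := val4' _ _ (sqfro_lattice_point fN) yg.
  by rewrite e -/(val _ _) in h1 *; lra.
have b0 : 0 <= 2 * b.
  apply: le_trans S2; have -> : 0 = val 0 0 by rewrite /val mulmx0 mxE.
  by apply: valS; rewrite (_ : sqfro 0 = 0) ?ler01 //; apply/eqP; rewrite sqfro_eq0.
move=> x y; pose p := Num.sqrt (sqfro x); pose q := Num.sqrt (sqfro y).
have pE : sqfro x = p ^+ 2 by rewrite sqr_sqrtr ?sqfro_ge0.
have qE : sqfro y = q ^+ 2 by rewrite sqr_sqrtr ?sqfro_ge0.
have rhs0 : 0 <= 2 * b * (sqfro x + sqfro y).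
  by rewrite mulr_ge0 // addr_ge0 ?sqfro_ge0.
have [x0|x0] := eqVneq x 0; first by rewrite x0 !mul0mx mxE mulr0 -x0.
have [y0|y0] := eqVneq y 0; first by rewrite y0 mulmx0 mxE mulr0 -y0.
have p0 : 0 < p by rewrite sqrtr_gt0 lt_neqAle eq_sym sqfro_eq0 x0 sqfro_ge0.
have q0 : 0 < q by rewrite sqrtr_gt0 lt_neqAle eq_sym sqfro_eq0 y0 sqfro_ge0.
have h : val (p^-1 *: x^T) (q^-1 *: y) <= 2 * b.
  apply: le_trans S2; apply: valS; rewrite sqfroZ ?sqfro_tr.
    by rewrite pE -exprMn mulVf ?gt_eqF // expr1n.
  by rewrite qE -exprMn mulVf ?gt_eqF // expr1n.
have e : (x *m X *m y) 0 0 = p * q * val (p^-1 *: x^T) (q^-1 *: y).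
  rewrite /val.
  have -> : (p^-1 *: x^T)^T = p^-1 *: x by apply/matrixP => i j; rewrite !mxE.
  rewrite -!scalemxAl -scalemxAr scalerA [X in _ = _ * X]mxE.
  by field; rewrite !gt_eqF.
rewrite e pE qE; have pq : 0 < p * q by rewrite mulr_gt0.
have := ler_wpM2l (ltW pq) h; have := mulr_ge0 b0 (sqr_ge0 (p - q)).
rewrite sqrrB; lra.
Qed.

End LatticeNet.

(** * Measurability of the thresholded matrix *)

Section MeasurableMatrices.
Context d (T : measurableType d) (R : realType).

Definition mx_measurable m n (Y : T -> 'M[R]_(m, n)) :=
  forall i j, measurable_fun [set: T] (fun w => Y w i j).

(** The inverse is [x] times the power -1 of the nonnegative [x^2], also at 0, where the inverse is
    0 by convention. *)
Lemma measurable_funV (f : T -> R) : measurable_fun [set: T] f ->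
  measurable_fun [set: T] (fun w => (f w)^-1).
Proof.
move=> mf; rewrite (_ : (fun w => _) = (fun w => f w * powR (f w ^+ 2) (-1))).
  apply: measurable_funM => //.
  apply: (@measurableT_comp _ _ _ _ _ _ (fun x : R => powR x (-1))).
    exact: measurable_powR.
  exact: measurable_funX.
apply/funext => w; rewrite powR_inv1 ?sqr_ge0 //.
have [->|f0] := eqVneq (f w) 0; first by rewrite invr0 mul0r.
by field.
Qed.

Lemma mx_measurable_cst m n (A : 'M[R]_(m, n)) : mx_measurable (fun=> A).
Proof. by move=> i j; exact: measurable_cst. Qed.

Lemma mx_measurableD m n (Y Z : T -> 'M[R]_(m, n)) :
  mx_measurable Y -> mx_measurable Z -> mx_measurable (fun w => Y w + Z w).
Proof.
move=> mY mZ i j; under eq_fun do rewrite mxE.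
exact: measurable_funD.
Qed.

Lemma mx_measurableM m n p (Y : T -> 'M[R]_(m, n)) (Z : T -> 'M[R]_(n, p)) :
  mx_measurable Y -> mx_measurable Z -> mx_measurable (fun w => Y w *m Z w).
Proof.
move=> mY mZ i j; under eq_fun do rewrite mxE.
by apply: measurable_sum => k; apply: measurable_funM.
Qed.

Lemma mx_measurableZ m n (f : T -> R) (Y : T -> 'M[R]_(m, n)) :
  measurable_fun [set: T] f -> mx_measurable Y ->
  mx_measurable (fun w => f w *: Y w).
Proof.
move=> mf mY i j; under eq_fun do rewrite mxE.
exact: measurable_funM.
Qed.

Lemma mx_measurable_tr m n (Y : T -> 'M[R]_(m, n)) :
  mx_measurable Y -> mx_measurable (fun w => (Y w)^T).
Proof. by move=> mY i j; under eq_fun do rewrite mxE; exact: mY. Qed.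

Lemma mx_measurableX n (Y : T -> 'M[R]_n.+1) k :
  mx_measurable Y -> mx_measurable (fun w => Y w ^+ k).
Proof.
move=> mY; elim: k => [|k IH]; first exact: mx_measurable_cst.
by under eq_fun do rewrite exprS; apply: mx_measurableM.
Qed.

Lemma measurable_det n (Y : T -> 'M[R]_n) :
  mx_measurable Y -> measurable_fun [set: T] (fun w => \det (Y w)).
Proof.
move=> mY; rewrite /determinant; apply: measurable_sum => s.
by apply: measurable_funM => //; apply: measurable_prod => i _; exact: mY.
Qed.

(** Cramer's rule: determinant and cofactors are polynomials in the entries. *)
Lemma mx_measurable_inv n (Y : T -> 'M[R]_n) :
  (forall w, Y w \in unitmx) -> mx_measurable Y ->
  mx_measurable (fun w => invmx (Y w)).
Proof.
move=> uY mY; under eq_fun do rewrite /invmx uY.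
apply: mx_measurableZ; first by apply: measurable_funV; exact: measurable_det.
move=> i j; under eq_fun do rewrite mxE /cofactor.
apply: measurable_funM => //; apply: measurable_det => k l.
by under eq_fun do rewrite !mxE; exact: mY.
Qed.

Lemma measurable_sqfro m n (Y : T -> 'M[R]_(m, n)) :
  mx_measurable Y -> measurable_fun [set: T] (fun w => sqfro (Y w)).
Proof.
move=> mY; apply: measurable_sum => i; apply: measurable_sum => j.
exact: measurable_funX.
Qed.

End MeasurableMatrices.

(** * Rational approximation of a step function *)

Section ThresholdLimit.
Variable R : realType.

(* A rational approximation of the indicator of ]c, +oo[: the quotient tends to
   0, 1/2, 1 below, at and above c, and x (2 x - 1) sends these to 0, 0, 1. *)
Definition soft_step (c t : R) k :=
  let q := t ^+ k * (c ^+ k + t ^+ k)^-1 in q * (2 * q - 1).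

Local Open Scope classical_set_scope.

(** Dividing by the larger power reduces the quotient to [z^k / (1 + z^k)] with [z < 1], or to its
    complement to 1. At [t = c] every term is exactly 0, matching the strict threshold. *)
Lemma cvg_soft_step (c t : R) : 0 < c -> 0 <= t ->
  soft_step c t @ \oo --> ((c < t)%R%:R : R).
Proof.
move=> c0 t0.
have lim0 (z : R) : 0 <= z < 1 -> (fun k => z ^+ k * (1 + z ^+ k)^-1) @ \oo --> (0 : R).
  case/andP=> z0 z1; rewrite -(mul0r (1 + 0)^-1).
  have zk : (fun k => z ^+ k) @ \oo --> (0 : R) by apply: cvg_expr; rewrite ger0_norm.
  apply: cvgM => //; apply: cvgV; first by rewrite addr0 oner_neq0.
  by apply: cvgD => //; exact: cvg_cst.
have step (q : nat -> R) (l : R) : q @ \oo --> l ->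
    (fun k => q k * (2 * q k - 1)) @ \oo --> l * (2 * l - 1).
  move=> ql; apply: cvgM => //; apply: cvgB; last exact: cvg_cst.
  by apply: cvgM => //; exact: cvg_cst.
have ck k : 0 < c ^+ k by rewrite exprn_gt0.
have cz k : 0 <= (t / c) ^+ k by rewrite exprn_ge0 // divr_ge0 // ltW.
case: ltgtP => [ct|tc|ct].
- have tgt0 : 0 < t by exact: lt_trans ct.
  have tk k : 0 < t ^+ k by rewrite exprn_gt0.
  have := step (fun k => 1 - (c / t) ^+ k * (1 + (c / t) ^+ k)^-1) 1.
  rewrite mulr1 (_ : 1 * (2 - 1) = 1 :> R); last by lra.
  move=> h; have {}h := h _.
  rewrite [X in X @ \oo --> _](_ : _ = (fun k : nat =>
    (1 - (c / t) ^+ k * (1 + (c / t) ^+ k)^-1) *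
    (2 * (1 - (c / t) ^+ k * (1 + (c / t) ^+ k)^-1) - 1))); last first.
    apply/funext => k; rewrite /soft_step expr_div_n.
    suff -> : t ^+ k / (c ^+ k + t ^+ k) =
      1 - c ^+ k / t ^+ k / (1 + c ^+ k / t ^+ k) by [].
    have := ck k; have := tk k; move: (c ^+ k) (t ^+ k) => a b b0 a0.
    by field; rewrite !gt_eqF // addr_gt0.
  apply: h; rewrite -[X in _ --> X]subr0; apply: cvgB; first exact: cvg_cst.
  by apply: lim0; rewrite divr_ge0 ?(ltW c0) //= ltr_pdivrMr // mul1r.
- have := step (fun k => (t / c) ^+ k * (1 + (t / c) ^+ k)^-1) 0.
  rewrite mul0r => h.
  rewrite [X in X @ \oo --> _](_ : _ = (fun k : nat =>
    ((t / c) ^+ k * (1 + (t / c) ^+ k)^-1) *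
    (2 * ((t / c) ^+ k * (1 + (t / c) ^+ k)^-1) - 1))); last first.
    apply/funext => k; rewrite /soft_step.
    suff -> : t ^+ k / (c ^+ k + t ^+ k) =
      (t / c) ^+ k / (1 + (t / c) ^+ k) by [].
    have tE : t ^+ k = (t / c) ^+ k * c ^+ k by rewrite -exprMn divfK ?gt_eqF.
    rewrite [in LHS]tE; have := ck k; have := cz k.
    move: (c ^+ k) ((t / c) ^+ k) => a b b0 a0.
    by field; rewrite !gt_eqF //; nra.
  by apply: h; apply: lim0; rewrite divr_ge0 ?(ltW c0) //= ltr_pdivrMr // mul1r.
- rewrite -ct [X in X @ \oo --> _](_ : _ = (fun=> 0)); first exact: cvg_cst.
  apply/funext => k; rewrite /soft_step; have := ck k; move: (c ^+ k) => a a0.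
  by field; rewrite gt_eqF // addr_gt0.
Qed.

End ThresholdLimit.

(** * Thresholding as a limit of rational functions of the matrix *)

Section MeasurableThresholding.
Context d (T : measurableType d) (R : realType).
Variables (m n : nat) (u : T -> 'M[R]_(m, n.+1)) (v : T -> 'M[R]_n.+1).
Variables (lam : T -> 'I_n.+1 -> R) (rho : R).
Hypotheses (uu : forall w, (u w)^T *m u w = 1%:M).
Hypotheses (vv : forall w, (v w)^T *m v w = 1%:M).
Hypotheses (lam_ge0 : forall w i, 0 <= lam w i) (rho_gt0 : 0 < rho).

Lemma svd_mx_id w : svd_mx (v w) (v w) (fun=> 1) = 1%:M.
Proof.
rewrite svd_mx_diag (_ : diag_mx _ = 1%:M) ?mulmx1 ?(mulmx1C (vv w)) //.
by apply/matrixP => i j; rewrite !mxE.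
Qed.

Lemma mx_measurable_thresholded :
  mx_measurable (fun w => svd_mx (u w) (v w) (lam w)) ->
  mx_measurable (fun w => svd_mx (u w) (v w) (thresholded (lam w) rho)).
Proof.
move=> my; pose y w := svd_mx (u w) (v w) (lam w).
(* [A] has eigenvalues [lam^2], [Q k] is the quotient of [soft_step] at threshold [rho^2], and [Z k]
   applies [soft_step] to [y]. All are rational in [y], although the singular vectors may depend on
   [w] in a nonmeasurable way. *)
pose A w : 'M[R]_n.+1 := (y w)^T *m y w.
pose G k w : 'M[R]_n.+1 := (rho ^+ 2) ^+ k *: 1%:M + A w ^+ k.
pose Q k w := A w ^+ k *m invmx (G k w).
pose Z k w := y w *m (Q k w *m (2 *: Q k w + - 1%:M)).
have AE w k : A w ^+ k = svd_mx (v w) (v w) (fun i => (lam w i ^+ 2) ^+ k).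
  have A1 : A w = svd_mx (v w) (v w) (fun i => lam w i ^+ 2).
    by rewrite /A /y tr_svd_mx mul_svd_mx.
  elim: k => [|k IH].
    by rewrite -[LHS](svd_mx_id w); apply: eq_bigr => i _; rewrite expr0.
  rewrite exprS IH A1 -[LHS]/(_ *m _) mul_svd_mx //.
  by apply: eq_bigr => i _; rewrite [in RHS]exprS.
have GE w k : G k w =
    svd_mx (v w) (v w) (fun i => (rho ^+ 2) ^+ k + (lam w i ^+ 2) ^+ k).
  rewrite /G AE -(svd_mx_id w) scaler_sumr -big_split; apply: eq_bigr => i _ /=.
  by rewrite scalerA mulr1 scalerDl.
have Gpos w k i : 0 < (rho ^+ 2) ^+ k + (lam w i ^+ 2) ^+ k.
  by rewrite ltr_wpDr ?exprn_ge0 ?exprn_gt0.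
have GV w k : G k w *m svd_mx (v w) (v w)
    (fun i => ((rho ^+ 2) ^+ k + (lam w i ^+ 2) ^+ k)^-1) = 1%:M.
  rewrite GE mul_svd_mx // -(svd_mx_id w); apply: eq_bigr => i _.
  by rewrite divff ?gt_eqF.
have uG w k : G k w \in unitmx by have [] := mulmx1_unit (GV w k).
have QE w k : Q k w = svd_mx (v w) (v w) (fun i =>
    (lam w i ^+ 2) ^+ k * ((rho ^+ 2) ^+ k + (lam w i ^+ 2) ^+ k)^-1).
  rewrite /Q AE -[invmx _]mulmx1 -(GV w k) mulKmx // mul_svd_mx //.
have ZE w k : Z k w = svd_mx (u w) (v w) (fun i =>
    lam w i * soft_step (rho ^+ 2) (lam w i ^+ 2) k).
  rewrite /Z QE -[in - 1%:M](svd_mx_id w).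
  set f := fun i => _ * _^-1.
  have -> : 2 *: svd_mx (v w) (v w) f + - svd_mx (v w) (v w) (fun=> 1) =
      svd_mx (v w) (v w) (fun i => 2 * f i - 1).
    rewrite scaler_sumr -sumrN -big_split; apply: eq_bigr => i _ /=.
    by rewrite scalerA scalerBl.
  by rewrite mul_svd_mx // mul_svd_mx.
have mA : mx_measurable A by apply: mx_measurableM => //; apply: mx_measurable_tr.
have mQ k : mx_measurable (Q k).
  apply: mx_measurableM; first exact: mx_measurableX.
  apply: mx_measurable_inv => // ; apply: mx_measurableD.
    exact: mx_measurable_cst.
  exact: mx_measurableX.
have mZ k : mx_measurable (Z k).
  apply: mx_measurableM => //; apply: mx_measurableM => //.
  apply: mx_measurableD; last exact: mx_measurable_cst.
  by apply: mx_measurableZ => //; exact: measurable_cst.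
move=> i j; apply: (@measurable_fun_cvg _ _ _ _ (fun k w => Z k w i j)) => [k|w _].
  exact: mZ.
under eq_fun do rewrite ZE svd_mxE.
rewrite svd_mxE; apply: cvg_big => [|l _]; first exact: add_continuous.
apply: cvgM; last exact: cvg_cst.
rewrite /thresholded; have := @cvg_soft_step _ (rho ^+ 2) (lam w l ^+ 2).
have r0 := ltW rho_gt0.
rewrite exprn_gt0 // sqr_ge0 ltr_pXn2r ?nnegrE // => /(_ isT isT) h.
rewrite (_ : (if _ then _ else _) = lam w l * (rho < lam w l)%R%:R); last first.
  by case: ifP; rewrite ?mulr1 ?mulr0.
by apply: cvgM => //; exact: cvg_cst.
Qed.

End MeasurableThresholding.

(** * Operator norm of subgaussian noise *)

Lemma frobenius_sqr (R : realType) m n (A : 'M[R]_(m, n)) :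
  frobenius A ^+ 2 = sqfro A.
Proof. by rewrite sqr_sqrtr // sqfro_ge0. Qed.

Lemma sqfro_outer (R : realFieldType) m n (x : 'cV[R]_m) (y : 'cV[R]_n) :
  sqfro (x *m y^T) = sqfro x * sqfro y.
Proof.
rewrite /sqfro mulr_suml; apply: eq_bigr => i _; rewrite big_ord1 mulr_sumr.
by apply: eq_bigr => j _; rewrite big_ord1 !mxE big_ord1 !mxE exprMn.
Qed.

Section SubgaussianOperatorNorm.
Context (R : realType) (d : measure_display) (T : measurableType d).
Variables (P : probability T R) (m1 m2 : nat) (sigma : R).
Variable eps : T -> 'M[R]_(m1.+1, m2.+1).
Hypotheses (m21 : (m2 <= m1)%N) (sigma_gt0 : 0 < sigma).
Hypothesis epsP : subG P (sigma ^+ 2) eps.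

Local Notation n1 := (m1.+1%:R : R).

Definition net_form (p : lattice_code m1 * lattice_code m2) (w : T) : R :=
  ((lattice_point R p.1)^T *m eps w *m lattice_point R p.2) 0 0.

Definition net_pairs := enum (finset.setX (lattice_net m1) (lattice_net m2)).

(** Chernoff sum over the net. The slope bounds each exponential moment by [exp (n1 / 2)], and 38
    covers 18 + 18 for the two nets, 1/2 for the moment and 1 for the final [exp (- n1)]. *)
Definition noise_excess (w : T) : R := \sum_(p <- net_pairs)
  expR (Num.sqrt n1 / sigma * net_form p w - 38 * n1).

Lemma measurable_net_form p : measurable_fun [set: T] (net_form p).
Proof.
have [meps _ _] := epsP; rewrite /net_form.
suff h : mx_measurable (fun w =>
  (lattice_point R p.1)^T *m eps w *m lattice_point R p.2) by exact: h.
apply: mx_measurableM; last exact: mx_measurable_cst.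
by apply: mx_measurableM => //; exact: mx_measurable_cst.
Qed.

Lemma measurable_noise_term p : measurable_fun [set: T]
  (fun w => expR (Num.sqrt n1 / sigma * net_form p w - 38 * n1)).
Proof.
apply: measurableT_comp => //; apply: measurable_funB => //.
by apply: measurable_funM => //; exact: measurable_net_form.
Qed.

Lemma measurable_noise_excess : measurable_fun [set: T] noise_excess.
Proof. by apply: measurable_sum => p; exact: measurable_noise_term. Qed.

Lemma noise_excess_ge0 w : 0 <= noise_excess w.
Proof. by apply: sumr_ge0 => p _; exact: expR_ge0. Qed.

(** The form is the trace pairing of the noise with a rank one matrix; after scaling, its squared
    norm is at most [n1 / sigma^2]. *)
Lemma expectation_noise_term p : p \in net_pairs ->
  (\int[P]_w (expR (Num.sqrt n1 / sigma * net_form p w - 38 * n1))%:E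
    <= (expR (n1 / 2 - 38 * n1))%:E)%E.
Proof.
rewrite mem_enum finset.inE => /andP[fN gN]; have [meps _ mgf] := epsP.
pose l : R := Num.sqrt n1 / sigma.
pose M := l *: (lattice_point R p.1 *m (lattice_point R p.2)^T).
have trM w : \tr (M^T *m eps w) = l * net_form p w.
  have -> : M^T = l *: (lattice_point R p.2 *m (lattice_point R p.1)^T).
    by rewrite /M -[in RHS](trmxK (lattice_point R p.2)) -trmx_mul;
      apply/matrixP => i j; rewrite !mxE.
  rewrite -scalemxAl mxtraceZ -mulmxA mxtrace_mulC; congr (_ * _).
  by rewrite /mxtrace big_ord1.
have frM : sigma ^+ 2 * frobenius M ^+ 2 / 2 <= n1 / 2.
  have l2 : sigma ^+ 2 * l ^+ 2 = n1.
    by rewrite -exprMn mulrC divfK ?gt_eqF // sqr_sqrtr.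
  rewrite ler_pM2r ?invr_gt0 // frobenius_sqr sqfroZ sqfro_outer (mulrA (sigma ^+ 2)) l2.
  rewrite ler_piMr // -[X in _ <= X]mulr1.
  by rewrite ler_pM ?sqfro_ge0 ?sqfro_lattice_point.
under eq_integral do rewrite expRB EFinM.
rewrite ge0_integralZr //=.
- rewrite expRB EFinM lee_pmul2r // ?lte_fin ?invr_gt0 ?expR_gt0 //.
  have := mgf M; rewrite unlock.
  under eq_integral do rewrite trM.
  move=> h; apply: le_trans h _; by rewrite lee_fin ler_expR.
- apply/measurable_EFinP; apply: measurableT_comp => //.
  by apply: measurable_funM => //; exact: measurable_net_form.
Qed.

Lemma expectation_noise_excess : (\int[P]_w (noise_excess w)%:E <= (expR (- n1))%:E)%E.
Proof.
rewrite /noise_excess; under eq_integral do rewrite -sumEFin.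
rewrite ge0_integral_sum //=; last first.
  by move=> p; apply/measurable_EFinP; exact: measurable_noise_term.
rewrite big_seq; apply: le_trans (lee_sum _ expectation_noise_term) _.
rewrite -big_seq sumEFin lee_fin big_enum sumr_const cardsX -[_ *+ (_ * _)]mulr_natl natrM.
have two_expR k : (k <= m1)%N -> 2 ^+ (18 * k.+1) <= expR (18 * n1).
  move=> km; apply: le_trans (_ : _ <= expR 1 ^+ (18 * m1.+1)) _.
    apply: le_trans (_ : _ <= 2 ^+ (18 * m1.+1)) _.
      by rewrite ler_weXn2l ?ler1n // leq_mul2l.
    rewrite lerXn2r ?nnegrE ?expR_ge0 //.
    by have := expR_ge1Dx (1 : R); lra.
  by rewrite -expRM_natl mulr1 natrM.
apply: le_trans (_ : _ <= expR (18 * n1) * expR (18 * n1) * expR (n1 / 2 - 38 * n1)) _.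
  rewrite ler_wpM2r ?expR_ge0 // ler_pM //.
    exact: le_trans (card_lattice_net _ _) (two_expR _ _).
  exact: le_trans (card_lattice_net _ _) (two_expR _ _).
by rewrite -!expRD ler_expR; have : 0 <= n1 by []; lra.
Qed.

(** A single term is at most the whole nonnegative sum, so [bP] bounds every exponent; the factor 2
    comes from the net. *)
Lemma opnorm_le_noise w (b : R) : 38 * n1 <= b ->
  (forall t, expR (t - 38 * n1) <= noise_excess w -> t <= b) ->
  opnorm_le (eps w) (2 * (b * sigma / Num.sqrt n1)).
Proof.
move=> b0 bP; apply: opnorm_le_net => f g fN gN.
have s0 : 0 < Num.sqrt n1 by rewrite sqrtr_gt0.
rewrite -/(net_form (f, g) w) ler_pdivlMr // mulrC -ler_pdivrMr // mulrAC.
apply: bP; rewrite /noise_excess (bigD1_seq (f, g)) ?enum_uniq //=.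
  by rewrite lerDl sumr_ge0 // => p _; exact: expR_ge0.
by rewrite mem_enum finset.inE fN gN.
Qed.

(** Halving the exponent before using [1 + x <= exp x] gives growth like the square root of the
    excess, so squared operator norms grow only linearly in it. *)
Lemma noise_exponent_le w t : expR (t - 38 * n1) <= noise_excess w ->
  t <= 38 * n1 + 2 * (Num.sqrt (noise_excess w) - 1).
Proof.
set X := noise_excess w => h.
have : expR ((t - 38 * n1) / 2) <= Num.sqrt X.
  rewrite -(@ler_pXn2r _ 2%N) ?nnegrE ?expR_ge0 ?sqrtr_ge0 //.
  rewrite sqr_sqrtr ?noise_excess_ge0 // -expRM_natl; apply: le_trans h.
  by rewrite ler_expR; lra.
by have := expR_ge1Dx ((t - 38 * n1) / 2); lra.
Qed.

Lemma opnorm_le_noise_excess w : opnorm_le (eps w)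
  (2 * ((38 * n1 + 2 * Num.sqrt (noise_excess w)) * sigma / Num.sqrt n1)).
Proof.
apply: opnorm_le_noise => [|t /noise_exponent_le]; last by lra.
by have := sqrtr_ge0 (noise_excess w); lra.
Qed.

Lemma opnorm_le_noise_good w : noise_excess w <= 1 ->
  opnorm_le (eps w) (76 * sigma * Num.sqrt n1).
Proof.
move=> X1; have -> : 76 * sigma * Num.sqrt n1 =
    2 * (38 * n1 * sigma / Num.sqrt n1).
  rewrite -[X in 38 * X](@sqr_sqrtr _ n1) ?ler0n //.
  by field; rewrite gt_eqF // sqrtr_gt0.
apply: opnorm_le_noise => // t /noise_exponent_le h.
have : Num.sqrt (noise_excess w) <= 1 by rewrite -sqrtr1 ler_sqrt.
lra.
Qed.

End SubgaussianOperatorNorm.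

(** * Bounds on the loss *)

(* The rank r is chosen to balance r sigma^2 / n2 against V^2 / r^3. *)
Lemma balanced_rank (R : realType) (sigma V : R) (n2 : nat) :
  0 < sigma -> 0 <= V -> exists2 r, (0 < r)%N &
  r%:R * sigma ^+ 2 / n2.+1%:R + V ^+ 2 / r%:R ^+ 3 <=
  2 * (sigma ^+ 2 / n2.+1%:R + powR sigma (3 / 2) * powR V (1 / 2)
         / powR n2.+1%:R (3 / 4)).
Proof.
move=> s0 V0; set n : R := n2.+1%:R; have n0 : 0 < n by [].
(* In terms of these roots all the powers involved become integral, and the identities below are
   rational. *)
pose a := powR sigma (1 / 2); pose b := powR V (1 / 2); pose c := powR n (1 / 4).
have a0 : 0 < a by exact: powR_gt0.
have c0 : 0 < c by exact: powR_gt0.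
have b0 : 0 <= b by exact: powR_ge0.
have [a0' c0' s0' n0'] := And4 (ltW a0) (ltW c0) (ltW s0) (ltW n0).
have half : 1 / 2 * 2%:R = 1 :> R by lra.
have quarter : 1 / 4 * 4%:R = 1 :> R by lra.
have aE : sigma = a ^+ 2 by rewrite -powR_mulrn // -powRrM half powRr1.
have bE : V = b ^+ 2 by rewrite -powR_mulrn // -powRrM half powRr1.
have cE : n = c ^+ 4 by rewrite -powR_mulrn // -powRrM quarter powRr1.
have a3 : powR sigma (3 / 2) = a ^+ 3.
  by rewrite -powR_mulrn // -powRrM; congr (powR _ _); lra.
have c3 : powR n (3 / 4) = c ^+ 3.
  by rewrite -powR_mulrn // -powRrM; congr (powR _ _); lra.
(* This [x] equates [x sigma^2 / n] with [V^2 / x^3]; the chosen rank lies in []x, x + 1]]. *)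
pose x := b * c / a; have x0 : 0 <= x by rewrite divr_ge0 ?mulr_ge0.
exists (Num.truncn x).+1 => //.
have /andP[xl xu] := truncn_itv x0; set r : R := (Num.truncn x).+1%:R.
have r0 : 0 < r by [].
have rx : r <= x + 1 by rewrite /r -natr1; lra.
rewrite a3 c3 -/b.
have e1 : a ^+ 3 * b / c ^+ 3 = x * sigma ^+ 2 / n.
  by rewrite /x aE cE; field; rewrite !gt_eqF.
have e2 : V ^+ 2 = x ^+ 4 * sigma ^+ 2 / n.
  by rewrite /x bE aE cE; field; rewrite !gt_eqF.
have sn : 0 <= sigma ^+ 2 / n by rewrite divr_ge0 ?sqr_ge0 // ltW.
have h1 : r * sigma ^+ 2 / n <= (x + 1) * (sigma ^+ 2 / n).
  by rewrite -mulrA ler_wpM2r.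
have h2 : V ^+ 2 / r ^+ 3 <= x * (sigma ^+ 2 / n).
  rewrite ler_pdivrMr ?exprn_gt0 // e2.
  rewrite (_ : _ / n = x * (sigma ^+ 2 / n) * x ^+ 3); last by ring.
  have xs : 0 <= x * (sigma ^+ 2 / n) by exact: mulr_ge0.
  by rewrite ler_wpM2l // lerXn2r ?nnegrE // ltW.
rewrite e1 -(mulrA x); apply: le_trans (lerD h1 h2) _.
by move: (sigma ^+ 2 / n) sn => s sge0; lra.
Qed.

Section Loss.
Context (R : realType) (m1 m2 : nat).
Variables (C sigma : R) (theta : 'M[R]_(m1.+1, m2.+1)).
Variables (pi1 : 'S_m1.+1) (pi2 : 'S_m2.+1).
Variables (lam : 'I_m2.+1 -> R) (u : 'M[R]_(m1.+1, m2.+1)) (v : 'M[R]_m2.+1).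
Variable E : 'M[R]_(m1.+1, m2.+1).
Hypotheses (C152 : 152 <= C) (sigma_gt0 : 0 < sigma).
Hypothesis svd_y : is_svd (permuted theta pi1 pi2 + E) lam u v.

Local Notation n1 := (m1.+1%:R : R).
Local Notation n2 := (m2.+1%:R : R).
Local Notation A := (permuted theta pi1 pi2).
Local Notation rho := (C * sigma * Num.sqrt n1).
Local Notation loss := ((n1 * n2)^-1 * sqfro (svt rho lam u v - A)).

Let s0 : 0 < Num.sqrt n1. Proof. by rewrite sqrtr_gt0. Qed.

Let C_gt0 : 0 < C. Proof. exact: lt_le_trans C152. Qed.

Let rho_gt0 : 0 < rho. Proof. by rewrite !mulr_gt0. Qed.

Let svtE : svt rho lam u v = svd_mx u v (thresholded lam rho).
Proof. by rewrite svd_mx_thresholded. Qed.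

(** The trivial splitting [B = 0], [D = A] is enough: the error has operator norm at most [b] and
    [n2] columns. *)
Lemma loss_le_opnorm tau b : opnorm_le E tau -> 0 < b -> rho + tau <= b ->
  loss <= b ^+ 2 / n1.
Proof.
case: svd_y => lam0 _ uu vv yE Etau b0 rtb.
have yE' : svd_mx u v lam = 0 + A + E by rewrite add0r yE.
have := opnorm_le_thresholding_error uu vv lam0 rho_gt0 yE' Etau.
rewrite add0r -svtE => /(opnorm_leW rtb) /(sqfro_opnorm_le b0) h.
rewrite mulrC ler_pdivrMr ?mulr_gt0 //.
by rewrite mulrA divfK ?pnatr_eq0.
Qed.

(** The bound by [sigma^2] uses only the operator norm; the other one uses the low rank
    approximation at the balanced [r], whose factor 2 turns [36 C^2 + 17] into the constant. *)
Lemma loss_le_good : anti_Monge theta ->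
  opnorm_le E (76 * sigma * Num.sqrt n1) ->
  loss <= (72 * C ^+ 2 + 34) *
    Num.min (sigma ^+ 2 / n2 + powR sigma (3 / 2) *
      powR (corner_variation theta) (1 / 2) / powR n2 (3 / 4)) (sigma ^+ 2).
Proof.
move=> aM Etau; set rate1 := (X in Num.min X _).
(* Here [152 = 2 * 76] puts the threshold at twice the noise level or more. *)
have tau_rho : 2 * (76 * sigma * Num.sqrt n1) <= rho.
  by have := ler_wpM2r (mulr_ge0 (ltW sigma_gt0) (ltW s0)) C152; lra.
have rtb : rho + 76 * sigma * Num.sqrt n1 <= 2 * rho.
  by have := ltW rho_gt0; lra.
have b0 : 0 < 2 * rho by rewrite mulr_gt0.
have rho2 : rho ^+ 2 = C ^+ 2 * sigma ^+ 2 * n1 by rewrite !exprMn sqr_sqrtr.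
suff [h1 h2] : loss <= (72 * C ^+ 2 + 34) * rate1 /\
    loss <= (72 * C ^+ 2 + 34) * sigma ^+ 2 by rewrite minEle; case: ifP.
split; last first.
  apply: le_trans (loss_le_opnorm Etau b0 rtb) _.
  rewrite exprMn rho2 mulrA mulfK ?pnatr_eq0 // mulrA ler_wpM2r ?sqr_ge0 //.
  by have := sqr_ge0 C; lra.
have [r r0 rP] := balanced_rank m2 sigma_gt0 (corner_variation_ge0 aM).
have [B [rB AB]] := anti_Monge_low_rank aM pi1 pi2 r0.
case: svd_y => lam0 _ uu vv yE.
have yE' : svd_mx u v lam = B + (A - B) + E by rewrite addrCA subrr addr0 yE.
have := sqfro_thresholding_error uu vv lam0 rho_gt0 yE' Etau tau_rho b0 rtb.
rewrite addrCA subrr addr0 -svtE => h.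
set V := corner_variation theta in rP AB.
(* [36 = 4 * 3 * 3] from [b = 2 rho] and rank at most [3 r]; [17 = 4 * 4 + 1]. *)
have {}h : sqfro (svt rho lam u v - A) <=
    36 * r%:R * rho ^+ 2 + 17 * sqfro (A - B).
  apply: le_trans h _; rewrite -(ler_nat R) natrM in rB.
  rewrite exprMn mulrDr -(addrA _ _ (sqfro _)).
  apply: lerD.
    have := sqr_ge0 rho => r2; have := ler_wpM2l r2 rB; lra.
  rewrite le_eqVlt; apply/orP; left; apply/eqP; field.
  by rewrite !gt_eqF.
rewrite mulrC ler_pdivrMr ?mulr_gt0 //; apply: le_trans h _.
rewrite rho2.
apply: le_trans (_ : _ <= (36 * C ^+ 2 + 17) * (r%:R * sigma ^+ 2 / n2 +
  V ^+ 2 / r%:R ^+ 3) * (n1 * n2)) _; last first.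
  rewrite ler_wpM2r ?mulr_ge0 // (_ : 72 * _ + _ = (36 * C ^+ 2 + 17) * 2); last by lra.
  by rewrite -(mulrA _ 2) ler_wpM2l // addr_ge0 // mulr_ge0 // sqr_ge0.
have t1 : r%:R * sigma ^+ 2 / n2 * (n1 * n2) = r%:R * sigma ^+ 2 * n1.
  by field; rewrite addrC natr1 pnatr_eq0.
have t2 : V ^+ 2 / r%:R ^+ 3 * (n1 * n2) = n1 * n2 * V ^+ 2 / r%:R ^+ 3 by ring.
rewrite -(mulrA (36 * C ^+ 2 + 17)) (mulrDl _ _ (n1 * n2)) t1 t2.
have g1 : 0 <= C ^+ 2 := sqr_ge0 C.
have g2 : 0 <= r%:R * sigma ^+ 2 * n1 by rewrite mulr_ge0 // mulr_ge0 // sqr_ge0.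
have g3 : 0 <= n1 * n2 * V ^+ 2 / r%:R ^+ 3.
  by rewrite divr_ge0 ?exprn_ge0 // mulr_ge0 ?sqr_ge0 // mulr_ge0.
rewrite (_ : 36 * _ * _ = 36 * (C ^+ 2 * (r%:R * sigma ^+ 2 * n1))); last by ring.
move: (r%:R * sigma ^+ 2 * n1) (n1 * n2 * V ^+ 2 / r%:R ^+ 3) AB g2 g3 => p q AB g2 g3.
have := mulr_ge0 g1 g3; lra.
Qed.

(** The noise norm grows like [Num.sqrt X], so the loss is linear in [X] and can be integrated;
    [80 = 76 + 4]. *)
Lemma loss_le_bad X : 1 <= X ->
  opnorm_le E (2 * ((38 * n1 + 2 * Num.sqrt X) * sigma / Num.sqrt n1)) ->
  loss <= (C + 80) ^+ 2 * sigma ^+ 2 * X.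
Proof.
move=> X1 Etau; have sX : 1 <= Num.sqrt X by rewrite -sqrtr1 ler_sqrt //; lra.
set b := (C + 80) * sigma * Num.sqrt n1 * Num.sqrt X.
have C80 : 0 < C + 80 by have := C152; lra.
have C76 : 0 <= C + 76 by have := C152; lra.
have b0 : 0 < b by rewrite !mulr_gt0 //; lra.
have X0 : 0 <= X by lra.
apply: le_trans (loss_le_opnorm Etau b0 _) _; last first.
  rewrite !exprMn !sqr_sqrtr // le_eqVlt; apply/orP; left; apply/eqP; field.
  by rewrite addrC natr1 pnatr_eq0.
have s1 : 1 <= Num.sqrt n1 by rewrite -[X in X <= _]sqrtr1 ler_sqrt // ler1n.
have -> : 2 * ((38 * n1 + 2 * Num.sqrt X) * sigma / Num.sqrt n1) =
    76 * sigma * Num.sqrt n1 + 4 * sigma * Num.sqrt X / Num.sqrt n1.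
  rewrite -[X in 38 * X](@sqr_sqrtr _ n1) //; by field; rewrite gt_eqF.
have h1 : 4 * sigma * Num.sqrt X / Num.sqrt n1 <= 4 * sigma * Num.sqrt X * Num.sqrt n1.
  have si : (Num.sqrt n1)^-1 <= 1 by rewrite invf_le1.
  rewrite ler_wpM2l //; last by apply: le_trans si s1.
  by rewrite !mulr_ge0 ?sqrtr_ge0 // ltW.
have h2 : (C + 76) * sigma * Num.sqrt n1 * 1 <= (C + 76) * sigma * Num.sqrt n1 * Num.sqrt X.
  by rewrite ler_wpM2l // !mulr_ge0 // ltW.
rewrite /b; lra.
Qed.

End Loss.

(** * The risk bound in probability and in expectation *)

Theorem theorem5 (R : realType) :
  exists C0 : R, 0 < C0 /\
  forall C : R, C0 <= C ->
  exists C' : R, 0 < C' /\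
  forall (m1 m2 : nat),
  let n1 := m1.+1 in let n2 := m2.+1 in
  (n2 <= n1)%N ->
  forall (sigma : R), 0 < sigma ->
  forall (d : measure_display) (T : measurableType d) (P : probability T R)
    (theta : 'M[R]_(n1, n2)) (pi1 : 'S_n1) (pi2 : 'S_n2)
    (eps y : T -> 'M[R]_(n1, n2))
    (lam : T -> 'I_n2 -> R) (u : T -> 'M[R]_(n1, n2)) (v : T -> 'M[R]_n2),
  anti_Monge theta ->
  subG P (sigma ^+ 2) eps ->
  (forall w, y w = permuted theta pi1 pi2 + eps w) ->
  (forall w, is_svd (y w) (lam w) (u w) (v w)) ->
  let rho := C * sigma * Num.sqrt n1%:R in
  let loss := fun w : T =>
    (n1%:R * n2%:R)^-1 *
    frobenius (svt rho (lam w) (u w) (v w) - permuted theta pi1 pi2) ^+ 2 in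
  let rate := Num.min
    (sigma ^+ 2 / n2%:R
     + sigma `^ (3 / 2) * corner_variation theta `^ (1 / 2)
         / n2%:R `^ (3 / 4))
    (sigma ^+ 2) in
  ((1 - expR (- n1%:R))%:E <= P [set w | (loss w <= C' * rate)%R]%classic)%E
  /\ ('E_P[loss] <= (C' * rate)%:E)%E.
Proof.
exists 152; split=> // C C152; pose c1 : R := 72 * C ^+ 2 + 34; pose c2 := (C + 80) ^+ 2.
have c10 : 0 < c1 by have := sqr_ge0 C; rewrite /c1; lra.
have c20 : 0 <= c2 by exact: sqr_ge0.
exists (c1 + c2); split; first by lra.
move=> m1 m2 n1 n2 n21 sigma sigma0 d T P theta pi1 pi2 eps y lam u v aM epsP yE svdP.
move=> rho loss rate; pose X := noise_excess sigma eps.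
have svdE w : is_svd (permuted theta pi1 pi2 + eps w) (lam w) (u w) (v w).
  by rewrite -yE.
have lossE w : loss w =
    (n1%:R * n2%:R)^-1 * sqfro (svt rho (lam w) (u w) (v w) - permuted theta pi1 pi2).
  by rewrite /loss frobenius_sqr.
have V0 := corner_variation_ge0 aM.
(* Both branches of the minimum dominate [sigma^2 / n2], which will absorb the exceptional event in
   the mean. *)
have rate_ge : sigma ^+ 2 / n2%:R <= rate.
  rewrite /rate minEle; case: ifP => _.
    by rewrite lerDl !mulr_ge0 ?powR_ge0 // invr_ge0 powR_ge0.
  by rewrite ler_pdivrMr // ler_peMr ?sqr_ge0 // ler1n.
have rate0 : 0 <= rate by apply: le_trans rate_ge; rewrite divr_ge0 ?sqr_ge0.
have loss0 w : 0 <= loss w.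
  by rewrite lossE mulr_ge0 ?sqfro_ge0 // invr_ge0 mulr_ge0.
have X0 w : 0 <= X w by exact: noise_excess_ge0.
have good w : X w <= 1 -> loss w <= c1 * rate.
  move=> X1; rewrite lossE; apply: (loss_le_good C152 sigma0 (svdE w) aM).
  exact: opnorm_le_noise_good.
have k0 : 0 <= c2 * sigma ^+ 2 by rewrite mulr_ge0 // sqr_ge0.
(* A bound valid at every outcome, so the mean needs no splitting of the space. *)
have all_w w : loss w <= c1 * rate + c2 * sigma ^+ 2 * X w.
  have [X1|X1] := leP (X w) 1.
    apply: le_trans (good w X1) _; by rewrite lerDl mulr_ge0.
  apply: (@le_trans _ _ (c2 * sigma ^+ 2 * X w)); last first.
    by rewrite lerDr mulr_ge0 // ltW.
  rewrite lossE; apply: (loss_le_bad C152 sigma0 (svdE w) (ltW X1)).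
  exact: opnorm_le_noise_excess.
have mX : measurable_fun [set: T] X by apply: (measurable_noise_excess epsP).
have EX : (\int[P]_w (X w)%:E <= (expR (- n1%:R))%:E)%E.
  exact: (expectation_noise_excess (n21 : (m2 <= m1)%N) sigma0 epsP).
have mloss : measurable_fun [set: T] loss.
  rewrite (_ : loss = fun w => (n1%:R * n2%:R)^-1 *
    sqfro (svt rho (lam w) (u w) (v w) - permuted theta pi1 pi2)); last exact/funext.
  apply: measurable_funM => //; apply: measurable_sqfro.
  apply: mx_measurableD; last exact: mx_measurable_cst.
  have -> : (fun w => svt rho (lam w) (u w) (v w)) =
      (fun w => svd_mx (u w) (v w) (thresholded (lam w) rho)).
    by apply/funext => w; rewrite svd_mx_thresholded.
  have rho0 : 0 < rho by rewrite !mulr_gt0 ?sqrtr_gt0 //; lra.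
  apply: mx_measurable_thresholded => //; try by move=> w; case: (svdP w).
  have -> : (fun w => svd_mx (u w) (v w) (lam w)) =
      (fun w => permuted theta pi1 pi2 + eps w).
    by apply/funext => w; rewrite -yE; case: (svdP w).
  by apply: mx_measurableD; [exact: mx_measurable_cst | case: epsP].
split.
- have mset : measurable [set w | loss w <= (c1 + c2) * rate]%classic.
    rewrite (_ : [set w | _] =
      setT `&` loss @^-1` `]-oo, ((c1 + c2) * rate)])%classic; last first.
      by apply/seteqP; split=> w /=; rewrite in_itv /=; [|case].
    by apply: mloss => //; exact: measurable_itv.
  have mbad : measurable [set w | 1%:E <= `|(X w)%:E|]%E%classic.
    rewrite (_ : [set w | _] = setT `&` X @^-1` `[1, +oo[)%classic; last first.
      by apply/seteqP; split=> w /=; rewrite in_itv /= lee_fin ger0_norm // andbT;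
        [|case].
    by apply: mX => //; exact: measurable_itv.
  (* Markov's inequality at level 1. *)
  have Pbad : (P [set w | 1%:E <= `|(X w)%:E|]%E%classic <= (expR (- n1%:R))%:E)%E.
    have := @le_integral_abse _ _ _ P setT measurableT (EFin \o X) 1 _ ltr01.
    rewrite setTI mul1e => h; apply: le_trans (h _) _; first exact/measurable_EFinP.
    by under eq_integral do rewrite /= ger0_norm //.
  apply: (@le_trans _ _ (P (~` [set w | 1%:E <= `|(X w)%:E|]%E)%classic)).
    rewrite probability_setC // EFinB; exact: leeB.
  apply: le_measure; rewrite ?inE //; first exact: measurableC.
  move=> w /= /negP; rewrite lee_fin ger0_norm // -ltNge => X1.
  apply: le_trans (good w (ltW X1)) _; rewrite ler_wpM2r //; lra.
- rewrite unlock.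
  apply: (@le_trans _ _ (\int[P]_w ((c1 * rate)%:E + (c2 * sigma ^+ 2)%:E * (X w)%:E))%E).
    apply: ge0_le_integral => //.
    + by move=> w _; rewrite lee_fin.
    + exact/measurable_EFinP.
    + by apply: emeasurable_funD => //; apply: measurable_funeM; exact/measurable_EFinP.
    + by move=> w _; rewrite -EFinM -EFinD lee_fin.
  rewrite ge0_integralD //=; last first.
    by apply: measurable_funeM; exact/measurable_EFinP.
  - by move=> w _; rewrite -EFinM lee_fin mulr_ge0.
  - by move=> w _; rewrite lee_fin mulr_ge0 // ltW.
  have -> : (\int[P]__ (c1 * rate)%:E = (c1 * rate)%:E)%E.
    rewrite (integral_cst P measurableT (c1 * rate)%:E) -[RHS]mule1; congr (_ * _)%E.
    exact: probability_setT.
  rewrite ge0_integralZl_EFin //=; first last.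
  - exact/measurable_EFinP.
  - by move=> w _; rewrite lee_fin.
  apply: (@le_trans _ _ ((c1 * rate)%:E + (c2 * sigma ^+ 2)%:E * (expR (- n1%:R))%:E)%E).
    by apply: leeD2l; apply: lee_wpmul2l => //; rewrite lee_fin.
  rewrite -EFinM -EFinD lee_fin (mulrDl c1 c2) lerD2l -mulrA ler_wpM2l //.
  (* The exceptional part is small enough because [n2 <= n1 <= exp n1]. *)
  apply: le_trans rate_ge; rewrite ler_wpM2l ?sqr_ge0 // expRN lef_pV2 ?posrE ?expR_gt0 //.
  apply: (@le_trans _ _ n1%:R); first by rewrite ler_nat.
  by have := expR_ge1Dx (n1%:R : R); lra.
Qed.
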